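(* Let $k$ be a commutative Noetherian ring and let $G$ be a finite group. If $V$ is a finitely generated $\mathscr{OI}_G$-module over $k$, then $\operatorname{reg}(V)<\infty$.
   Context: The category $\mathscr{OI}_G$ has as objects the nonnegative integers. For objects $r,s\geqslant 0$, the set of morphisms from $r$ to $s$ is the set of pairs $(f,g)$ where $f:\{1,\ldots,r\}\to\{1,\ldots,s\}$ is a strictly increasing map and $g:\{1,\ldots,r\}\to G$ is an arbitrary map. The composition of $(f_1,g_1):r\to s$ followed by $(f_2,g_2):s\to t$ is $(f_3,g_3)$, where $f_3=f_2\circ f_1$ and $g_3(i)=g_2(f_1(i))\cdot g_1(i)$ for $1\leqslant i\leqslant r$. Let $\mathcal{C}$ be the $k$-linearization of $\mathscr{OI}_G$ (so $\mathcal{C}(r,s)$ is the free $k$-module on the set of morphisms from $r$ to $s$). An $\mathscr{OI}_G$-module over $k$ is a $\mathcal{C}$-module, i.e. a covariant $k$-linear functor $V$ from $\mathcal{C}$ to $k$-modules; write $V_s=V(s)$. It is finitely generated if it contains a finite set of elements (of the various $V_s$) contained in no proper submodule. Homology: view $\mathcal{C}$ as the $k$-algebra $\bigoplus_{r\leqslant s}\mathcal{C}(r,s)$, a $\mathcal{C}$-module $V$ as $\bigoplus_s V_s$, and let $\mathfrak{m}=\bigoplus_{r<s}\mathcal{C}(r,s)$, a two-sided ideal. Put $H_0(V)=V/\mathfrak{m}V\cong\mathcal{C}/\mathfrak{m}\otimes_{\mathcal{C}}V$ and let $H_i(V)=\operatorname{Tor}_i^{\mathcal{C}}(\mathcal{C}/\mathfrak{m},V)$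 be its $i$-th left derived functor; these are $\mathcal{C}$-modules. The $i$-th homological degree is $\operatorname{hd}_i(V)=\sup\{s\geqslant 0\mid (H_i(V))_s\neq 0\}$ (possibly $\infty$), set to be $-1$ if this set is empty. The Castelnuovo-Mumford regularity is $\operatorname{reg}(V)=\sup\{\operatorname{hd}_i(V)-i\mid i\geqslant 0\}$. *)

(* Defs.v *)
From HB Require Import structures.
From mathcomp Require Import all_boot all_order all_algebra all_fingroup.
From mathcomp Require Import boolp classical_sets functions fsbigop.
From mathcomp Require Import generic_quotient constructive_ereal zify.

Set Implicit Arguments.
Unset Strict Implicit.
Unset Printing Implicit Defensive.

Import Order.TTheory GRing.Theory Num.Theory.
Local Open Scope classical_set_scope.
Local Open Scope ring_scope.
Local Open Scope quotient_scope.

Section Lmodules.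
Variable k : comPzRingType.

Definition mk_linear (U V : lmodType k) (f : U -> V) (lf : linear f) :
    {linear U -> V} :=
  HB.pack f (GRing.isLinear.Build k U V *:%R f lf).

Record lsub (M : lmodType k) := LSub {
  lsub_set :> M -> Prop;
  lsub0 : lsub_set 0;
  lsubP : forall (a : k) x y, lsub_set x -> lsub_set y -> lsub_set (a *: x + y)
}.

Lemma lsub_ext (M : lmodType k) (S : lsub M) x y : x = y -> S x -> S y.
Proof. by move=> ->. Qed.

Lemma lsubD (M : lmodType k) (S : lsub M) x y : S x -> S y -> S (x + y).
Proof. by move=> Sx Sy; rewrite -[x]scale1r; exact: lsubP. Qed.

Lemma lsubZ (M : lmodType k) (S : lsub M) a x : S x -> S (a *: x).
Proof. by move=> Sx; rewrite -[_ *: _]addr0; apply: lsubP => //; exact: lsub0. Qed.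

Lemma lsubN (M : lmodType k) (S : lsub M) x : S x -> S (- x).
Proof. by move=> Sx; rewrite -scaleN1r; exact: lsubZ. Qed.

Lemma lsub_sum (M : lmodType k) (S : lsub M) (I : Type) (r : seq I)
    (P : pred I) (F : I -> M) :
  (forall i, P i -> S (F i)) -> S (\sum_(i <- r | P i) F i).
Proof.
move=> SF; elim/big_ind: _ => //; first exact: lsub0.
by move=> x y; exact: lsubD.
Qed.

Section SubLmodule.
Variables (M : lmodType k) (S : lsub M).

Definition lsub_pred : {pred M} := [pred x | `[< S x >]].

Lemma lsub_predP : submod_closed lsub_pred.
Proof.
split; first by apply/asboolP; exact: lsub0.
by move=> a x y /asboolP Sx /asboolP Sy; apply/asboolP; exact: lsubP.
Qed.

HB.instance Definition _ := GRing.isSubmodClosed.Build k M lsub_pred lsub_predP.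

Definition sub_lmod := {x : M | x \in lsub_pred}.
HB.instance Definition _ := SubChoice.on sub_lmod.
HB.instance Definition _ := [SubChoice_isSubLmodule of sub_lmod by <:].

Definition sub_lmodType : lmodType k :=
  Eval unfold GRing.Lmodule.phant_clone in GRing.Lmodule.clone k sub_lmod _.

Lemma sub_val_linear : linear (fun x : sub_lmodType => val (x : sub_lmod)).
Proof. by []. Qed.

Definition sub_val : {linear sub_lmodType -> M} := mk_linear sub_val_linear.

Lemma sub_lmodP (x : sub_lmod) : S (val x).
Proof. by apply/asboolP; exact: (valP x). Qed.

Definition in_sub x (Sx : S x) : sub_lmod := Sub x (introT (asboolP _) Sx).
End SubLmodule.

Section QuotLmodule.
Variables (M : lmodType k) (S : lsub M).

Definition lquot_equiv : rel M := fun x y => `[< S (x - y) >].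

Lemma lquot_equivP : equiv_class_of lquot_equiv.
Proof.
split=> [x|x y|y x z].
- by apply/asboolP; rewrite subrr; exact: lsub0.
- by apply/asboolP/asboolP => /lsubN; rewrite opprB.
- move=> /asboolP xy /asboolP yz; apply/asboolP.
  by apply: lsub_ext (lsubD xy yz); rewrite addrA subrK.
Qed.

Canonical lquot_equivRel := EquivRelPack lquot_equivP.

Definition quot_lmod := {eq_quot lquot_equivRel}.
HB.instance Definition _ := Choice.on quot_lmod.
HB.instance Definition _ := EqQuotient.on quot_lmod.

Definition lpi (x : M) : quot_lmod := \pi_quot_lmod x.

Lemma lpi_eq x y : lpi x = lpi y <-> S (x - y).
Proof.
split; first by move/eqmodP => /asboolP.
by move=> h; apply/eqmodP/asboolP.
Qed.

Lemma lpi_surj (q : quot_lmod) : lpi (repr q) = q.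
Proof. exact: reprK. Qed.

Lemma lquot_ind (P : quot_lmod -> Prop) : (forall x, P (lpi x)) -> forall q, P q.
Proof. by move=> h q; rewrite -(lpi_surj q). Qed.

Lemma lpi_repr x : S (repr (lpi x) - x).
Proof. by apply/lpi_eq; rewrite lpi_surj. Qed.

Definition lq_add (p q : quot_lmod) := lpi (repr p + repr q).
Definition lq_opp (p : quot_lmod) := lpi (- repr p).
Definition lq_scale (a : k) (p : quot_lmod) := lpi (a *: repr p).

Lemma lq_addE x y : lq_add (lpi x) (lpi y) = lpi (x + y).
Proof.
apply/lpi_eq; apply: lsub_ext (lsubD (lpi_repr x) (lpi_repr y)).
by rewrite opprD addrACA.
Qed.

Lemma lq_oppE x : lq_opp (lpi x) = lpi (- x).
Proof.
by apply/lpi_eq; apply: lsub_ext (lsubN (lpi_repr x)); rewrite opprD.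
Qed.

Lemma lq_scaleE a x : lq_scale a (lpi x) = lpi (a *: x).
Proof.
by apply/lpi_eq; apply: lsub_ext (lsubZ a (lpi_repr x)); rewrite scalerBr.
Qed.

Lemma lq_addA : associative lq_add.
Proof.
elim/lquot_ind=> x; elim/lquot_ind=> y; elim/lquot_ind=> z.
by rewrite !lq_addE addrA.
Qed.
Lemma lq_addC : commutative lq_add.
Proof. by elim/lquot_ind=> x; elim/lquot_ind=> y; rewrite !lq_addE addrC. Qed.
Lemma lq_add0 : left_id (lpi 0) lq_add.
Proof. by elim/lquot_ind=> x; rewrite lq_addE add0r. Qed.
Lemma lq_addN : left_inverse (lpi 0) lq_opp lq_add.
Proof. by elim/lquot_ind=> x; rewrite lq_oppE lq_addE addNr. Qed.

HB.instance Definition _ :=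
  GRing.isZmodule.Build quot_lmod lq_addA lq_addC lq_add0 lq_addN.

Lemma lq_scaleA a b v : lq_scale a (lq_scale b v) = lq_scale (a * b) v.
Proof. by elim/lquot_ind: v => x; rewrite !lq_scaleE scalerA. Qed.
Lemma lq_scale1 : left_id 1 lq_scale.
Proof. by elim/lquot_ind=> x; rewrite lq_scaleE scale1r. Qed.
Lemma lq_scaleDr : right_distributive lq_scale +%R.
Proof.
move=> a; elim/lquot_ind=> x; elim/lquot_ind=> y.
by rewrite /GRing.add /= lq_addE !lq_scaleE lq_addE scalerDr.
Qed.
Lemma lq_scaleDl v : {morph lq_scale^~ v : a b / a + b}.
Proof.
move=> a b; elim/lquot_ind: v => x.
by rewrite [RHS]/GRing.add /= !lq_scaleE lq_addE scalerDl.
Qed.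

HB.instance Definition _ := GRing.Zmodule_isLmodule.Build k quot_lmod
  lq_scaleA lq_scale1 lq_scaleDr lq_scaleDl.

Definition quot_lmodType : lmodType k :=
  Eval unfold GRing.Lmodule.phant_clone in GRing.Lmodule.clone k quot_lmod _.

Lemma lpi_is_linear : linear lpi.
Proof.
move=> a x y.
by rewrite -[RHS]/(lq_add (lq_scale a (lpi x)) (lpi y)) lq_scaleE lq_addE.
Qed.
End QuotLmodule.

Section DirectSum.
Variables (I : choiceType) (M : I -> lmodType k).

Definition fin_supp (x : forall i, M i) : Prop :=
  exists s : seq I, forall i, i \notin s -> x i = 0.

Record dsum := DSum { dsum_fun :> forall i, M i; dsumP : fin_supp dsum_fun }.

Lemma dsum_ext (x y : dsum) : (forall i, x i = y i) -> x = y.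
Proof.
case: x y => [x fx] [y fy] /= h.
have e : x = y by apply: functional_extensionality_dep.
by case: _ / e fy => fy; congr DSum; exact: Prop_irrelevance.
Qed.

HB.instance Definition _ := gen_eqMixin dsum.
HB.instance Definition _ := gen_choiceMixin dsum.

Lemma ds0P : fin_supp (fun i => 0 : M i).
Proof. by exists [::]. Qed.
Lemma dsDP (x y : dsum) : fin_supp (fun i => x i + y i).
Proof.
case: x y => [x [s hs]] [y [t ht]] /=; exists (s ++ t) => i.
by rewrite mem_cat negb_or => /andP[/hs-> /ht->]; rewrite addr0.
Qed.
Lemma dsNP (x : dsum) : fin_supp (fun i => - x i).
Proof. by case: x => [x [s hs]] /=; exists s => i /hs->; rewrite oppr0. Qed.
Lemma dsZP (a : k) (x : dsum) : fin_supp (fun i => a *: x i).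
Proof. by case: x => [x [s hs]] /=; exists s => i /hs->; rewrite scaler0. Qed.

Lemma ds_addA : associative (fun x y : dsum => DSum (dsDP x y)).
Proof. by move=> x y z; apply: dsum_ext => i /=; rewrite addrA. Qed.
Lemma ds_addC : commutative (fun x y : dsum => DSum (dsDP x y)).
Proof. by move=> x y; apply: dsum_ext => i /=; rewrite addrC. Qed.
Lemma ds_add0 : left_id (DSum ds0P) (fun x y : dsum => DSum (dsDP x y)).
Proof. by move=> x; apply: dsum_ext => i /=; rewrite add0r. Qed.
Lemma ds_addN : left_inverse (DSum ds0P) (fun x => DSum (dsNP x))
  (fun x y : dsum => DSum (dsDP x y)).
Proof. by move=> x; apply: dsum_ext => i /=; rewrite addNr. Qed.

HB.instance Definition _ :=
  GRing.isZmodule.Build dsum ds_addA ds_addC ds_add0 ds_addN.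

Lemma ds_scaleA a b x : DSum (dsZP a (DSum (dsZP b x))) = DSum (dsZP (a * b) x).
Proof. by apply: dsum_ext => i /=; rewrite scalerA. Qed.
Lemma ds_scale1 : left_id 1 (fun a x => DSum (dsZP a x)).
Proof. by move=> x; apply: dsum_ext => i /=; rewrite scale1r. Qed.
Lemma ds_scaleDr : right_distributive (fun a x => DSum (dsZP a x)) +%R.
Proof. by move=> a x y; apply: dsum_ext => i /=; rewrite scalerDr. Qed.
Lemma ds_scaleDl x : {morph (fun a => DSum (dsZP a x)) : a b / a + b}.
Proof. by move=> a b; apply: dsum_ext => i /=; rewrite scalerDl. Qed.

HB.instance Definition _ := GRing.Zmodule_isLmodule.Build k dsum
  ds_scaleA ds_scale1 ds_scaleDr ds_scaleDl.

Lemma dsumDE (x y : dsum) i : (x + y) i = x i + y i. Proof. by []. Qed.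
Lemma dsumZE a (x : dsum) i : (a *: x) i = a *: x i. Proof. by []. Qed.
Lemma dsum0E i : (0 : dsum) i = 0. Proof. by []. Qed.

(* The map out of the direct sum induced by maps out of the summands. *)
Definition dsum_rec (N : lmodType k) (f : forall i, {linear M i -> N})
    (x : dsum) : N :=
  \sum_(i \in [set: I]) f i (x i).

Lemma dsum_recE (N : lmodType k) (f : forall i, {linear M i -> N}) (x : dsum)
    (s : seq I) : uniq s -> (forall i, i \notin s -> x i = 0) ->
  dsum_rec f x = \sum_(i <- s) f i (x i).
Proof.
move=> us hs; rewrite /dsum_rec fsbig_supp.
rewrite (fsbig_fwiden s) // => i /=.
  by case=> _ /eqP fi0; apply: contraNT fi0 => /hs->; rewrite linear0.
by case=> _ /not_andP[]// /contrapT.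
Qed.

Lemma dsum_support (x y : dsum) : exists s : seq I,
  [/\ uniq s, forall i, i \notin s -> x i = 0 & forall i, i \notin s -> y i = 0].
Proof.
case: (dsumP x) (dsumP y) => [s hs] [t ht]; exists (undup (s ++ t)).
by split=> [|i|i]; rewrite ?undup_uniq // mem_undup mem_cat negb_or;
  case/andP; [move=> /hs|move=> _ /ht].
Qed.

Lemma dsum_rec_linear (N : lmodType k) (f : forall i, {linear M i -> N}) :
  linear (dsum_rec f).
Proof.
move=> a x y; have [s [us hx hy]] := dsum_support x y.
rewrite !(@dsum_recE _ _ _ s) // => [|i si]; last first.
  by rewrite dsumDE dsumZE hx ?hy // scaler0 addr0.
rewrite scaler_sumr -big_split; apply: eq_bigr => i _.
by rewrite dsumDE dsumZE linearP.
Qed.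

Definition dinj_fun (i : I) (x : M i) (j : I) : M j :=
  if pselect (i = j) is left e then ecast j (M j) e x else 0.

Lemma dinj_funP i x : fin_supp (@dinj_fun i x).
Proof.
exists [:: i] => j; rewrite inE /dinj_fun => /eqP ji.
by case: pselect => // e; case: ji.
Qed.

Definition dinj i x : dsum := DSum (@dinj_funP i x).

Lemma dinj_same i x : dinj x i = x.
Proof.
by rewrite /= /dinj_fun; case: pselect => // e; rewrite (Prop_irrelevance e erefl).
Qed.

Lemma dinj_diff i x j : i != j -> @dinj i x j = 0.
Proof. by rewrite /= /dinj_fun => /eqP ij; case: pselect. Qed.

Lemma dsum_rec_inj (N : lmodType k) (f : forall i, {linear M i -> N}) i x :
  dsum_rec f (@dinj i x) = f i x.
Proof.
rewrite (@dsum_recE _ _ _ [:: i]) // ?big_seq1 ?dinj_same // => j.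
by rewrite inE eq_sym => ij; rewrite dinj_diff.
Qed.

Lemma dsum_decomp (x : dsum) (s : seq I) : uniq s ->
  (forall i, i \notin s -> x i = 0) -> x = \sum_(i <- s) dinj (x i).
Proof.
move=> us hs; apply: dsum_ext => j.
have -> : (\sum_(i <- s) dinj (x i)) j = \sum_(i <- s) dinj (x i) j.
  by elim/big_rec2: _ => // i y z _ <-.
have [js|js] := boolP (j \in s); last first.
  rewrite hs // big1_seq // => i si; apply: dinj_diff.
  by apply: contraNneq js => <-.
rewrite (bigD1_seq j js us) dinj_same big1 => [|i ij]; last exact: dinj_diff.
by rewrite [RHS]addr0.
Qed.

Definition dsum_lmodType : lmodType k :=
  Eval unfold GRing.Lmodule.phant_clone in GRing.Lmodule.clone k dsum _.
End DirectSum.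
End Lmodules.

(* Ideals are the submodules of the regular module k^o; the zero ring is not
   excluded. *)
Definition noetherian (k : comPzRingType) : Prop :=
  forall I : lsub k^o, exists gens : seq k,
    (forall x, x \in gens -> I x) /\
    (forall J : lsub k^o, (forall x, x \in gens -> J x) -> forall x, I x -> J x).

Section OIG.
Variable G : finGroupType.

Definition oi_increasing r s (f : {ffun 'I_r -> 'I_s}) : bool :=
  [forall i : 'I_r, forall j : 'I_r, (i < j)%N ==> (f i < f j)%N].

Record oi_hom r s := OIHom {
  oi_pair : {ffun 'I_r -> 'I_s} * {ffun 'I_r -> G};
  oi_pairP : oi_increasing oi_pair.1
}.
HB.instance Definition _ r s := [isSub for @oi_pair r s].
HB.instance Definition _ r s := [Finite of oi_hom r s by <:].

Definition oi_fun r s (x : oi_hom r s) := (oi_pair x).1.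
Definition oi_lab r s (x : oi_hom r s) := (oi_pair x).2.

Lemma oi_homP r s (x y : oi_hom r s) :
  oi_fun x =1 oi_fun y -> oi_lab x =1 oi_lab y -> x = y.
Proof.
move=> /ffunP hf /ffunP hg; apply: val_inj => /=.
by rewrite (surjective_pairing (oi_pair x)) (surjective_pairing (oi_pair y));
  congr pair.
Qed.

Lemma oi_idP r : oi_increasing [ffun i : 'I_r => i].
Proof. by apply/forallP=> i; apply/forallP=> j; rewrite !ffunE implybb. Qed.

Definition oi_id r : oi_hom r r :=
  @OIHom r r ([ffun i => i], [ffun=> 1%g]) (oi_idP r).

Lemma oi_compP r s t (y : oi_hom s t) (x : oi_hom r s) :
  oi_increasing [ffun i => oi_fun y (oi_fun x i)].
Proof.
apply/forallP=> i; apply/forallP=> j; rewrite !ffunE; apply/implyP=> ij.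
have /forallP/(_ (oi_fun x i))/forallP/(_ (oi_fun x j))/implyP := oi_pairP y.
apply.
by have /forallP/(_ i)/forallP/(_ j)/implyP/(_ ij) := oi_pairP x.
Qed.

(* [oi_comp y x] is x followed by y. *)
Definition oi_comp r s t (y : oi_hom s t) (x : oi_hom r s) : oi_hom r t :=
  @OIHom r t ([ffun i => oi_fun y (oi_fun x i)],
              [ffun i => (oi_lab y (oi_fun x i) * oi_lab x i)%g]) (oi_compP y x).

Lemma oi_compA r s t u (z : oi_hom t u) (y : oi_hom s t) (x : oi_hom r s) :
  oi_comp z (oi_comp y x) = oi_comp (oi_comp z y) x.
Proof. by apply: oi_homP => i; rewrite /oi_fun /oi_lab /= !ffunE ?mulgA. Qed.

Lemma oi_comp1l r s (x : oi_hom r s) : oi_comp (oi_id s) x = x.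
Proof.
by apply: oi_homP => i; rewrite /oi_fun /oi_lab /= !ffunE ?mul1g.
Qed.

Lemma oi_comp1r r s (x : oi_hom r s) : oi_comp x (oi_id r) = x.
Proof.
by apply: oi_homP => i; rewrite /oi_fun /oi_lab /= !ffunE ?mulg1.
Qed.

Lemma oi_fun_inj r s (x : oi_hom r s) : injective (oi_fun x).
Proof.
have inc (i j : 'I_r) : (i < j)%N -> (oi_fun x i < oi_fun x j)%N.
  by have /forallP/(_ i)/forallP/(_ j)/implyP := oi_pairP x.
move=> i j fij; case: (ltngtP i j) => [/inc|/inc|/val_inj //].
- by rewrite fij ltnn.
- by rewrite fij ltnn.
Qed.

Section Linearization.
Variable k : comPzRingType.

(* The free k-module on the finite set of morphisms r -> s. *)
Definition lin_hom r s := {ffun oi_hom r s -> k^o}.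
HB.instance Definition _ r s := GRing.Lmodule.on (lin_hom r s).

Definition lin_hom_lmodType r s : lmodType k :=
  Eval unfold GRing.Lmodule.phant_clone in GRing.Lmodule.clone k (lin_hom r s) _.

Definition lin_base r s (x : oi_hom r s) : lin_hom r s := [ffun y => (y == x)%:R].

Definition lin_id r : lin_hom r r := lin_base (oi_id r).

Definition lin_comp r s t (b : lin_hom s t) (a : lin_hom r s) : lin_hom r t :=
  \sum_(y : oi_hom s t) \sum_(x : oi_hom r s)
    (b y * a x) *: lin_base (oi_comp y x).

Lemma lin_hom_dec r s (a : lin_hom r s) : a = \sum_x a x *: lin_base x.
Proof.
apply/ffunP=> y; rewrite sum_ffunE (bigD1 y) //= big1 ?addr0.
  by rewrite !ffunE eqxx /GRing.scale /= mulr1.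
by move=> x xy; rewrite !ffunE eq_sym (negPf xy) /GRing.scale /= mulr0.
Qed.

Lemma lin_comp_linl r s t (a : lin_hom r s) :
  linear (fun b : lin_hom s t => lin_comp b a).
Proof.
move=> c b b'; rewrite /lin_comp scaler_sumr -big_split; apply: eq_bigr => y _.
rewrite /= scaler_sumr -big_split; apply: eq_bigr => x _.
by rewrite !ffunE mulrDl scalerDl scalerA mulrA.
Qed.

Lemma lin_comp_linr r s t (b : lin_hom s t) : linear (@lin_comp r s t b).
Proof.
move=> c a a'; rewrite /lin_comp scaler_sumr -big_split; apply: eq_bigr => y _.
rewrite /= scaler_sumr -big_split; apply: eq_bigr => x _.
by rewrite !ffunE mulrDr scalerDl scalerA mulrCA.
Qed.

Lemma lin_comp_base r s t (y : oi_hom s t) (x : oi_hom r s) :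
  lin_comp (lin_base y) (lin_base x) = lin_base (oi_comp y x).
Proof.
rewrite /lin_comp (bigD1 y) //= [X in _ + X]big1 ?addr0; last first.
  move=> y' yy'; rewrite big1 // => x' _.
  by rewrite !ffunE (negPf yy') mul0r scale0r.
rewrite (bigD1 x) //= big1 ?addr0; last first.
  by move=> x' xx'; rewrite !ffunE (negPf xx') mulr0 scale0r.
by rewrite !ffunE !eqxx mulr1 scale1r.
Qed.

Lemma lin_homW r s (V : lmodType k) (f g : lin_hom r s -> V) :
  linear f -> linear g -> (forall x, f (lin_base x) = g (lin_base x)) -> f =1 g.
Proof.
move=> lf lg fg a; rewrite -[f]/(mk_linear lf : _ -> _) -[g]/(mk_linear lg : _ -> _).
rewrite (lin_hom_dec a) !linear_sum; apply: eq_bigr => x _.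
by rewrite !linearZ; congr (_ *: _); exact: fg.
Qed.

Lemma lin_comp1l r s (a : lin_hom r s) : lin_comp (lin_id s) a = a.
Proof.
move: a; apply: lin_homW; [exact: lin_comp_linr|by []|move=> x].
by rewrite lin_comp_base oi_comp1l.
Qed.

Lemma lin_comp1r r s (a : lin_hom r s) : lin_comp a (lin_id r) = a.
Proof.
move: a; apply: (lin_homW (f := fun a => lin_comp a (lin_id r)) (g := id)).
- exact: lin_comp_linl.
- by [].
- by move=> x; rewrite lin_comp_base oi_comp1r.
Qed.

Lemma lin_compA r s t u (c : lin_hom t u) (b : lin_hom s t) (a : lin_hom r s) :
  lin_comp c (lin_comp b a) = lin_comp (lin_comp c b) a.
Proof.
move: a; apply: lin_homW => [e a a'|e a a'|x]; rewrite ?lin_comp_linr //.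
move: b; apply: (lin_homW (f := fun b => lin_comp c (lin_comp b _))
  (g := fun b => lin_comp (lin_comp c b) _)) => [e b b'|e b b'|y].
- by rewrite lin_comp_linl lin_comp_linr.
- by rewrite lin_comp_linr lin_comp_linl.
move: c; apply: (lin_homW (f := fun c => lin_comp c _)
  (g := fun c => lin_comp (lin_comp c _) _)) => [e c c'|e c c'|z].
- by rewrite lin_comp_linl.
- by rewrite !lin_comp_linl.
by rewrite !lin_comp_base oi_compA.
Qed.

(* k-linear functors from the linearization of OI_G to k-modules. *)
Record OImod := {
  OIob :> nat -> lmodType k;
  OIact : forall r s, lin_hom r s -> OIob r -> OIob s;
  OIact_linl : forall r s (v : OIob r), linear (fun a : lin_hom r s => OIact a v);
  OIact_linr : forall r s (a : lin_hom r s), linear (OIact a);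
  OIact_id : forall r (v : OIob r), OIact (lin_id r) v = v;
  OIact_comp : forall r s t (b : lin_hom s t) (a : lin_hom r s) (v : OIob r),
    OIact (lin_comp b a) v = OIact b (OIact a v)
}.

Record OIhom (V W : OImod) := {
  OIfun : forall s, {linear V s -> W s};
  OIfunP : forall r s (a : lin_hom r s) (v : V r),
    OIfun s (OIact a v) = OIact a (OIfun r v)
}.

Record OIsub (V : OImod) := {
  OIsub_lsub :> forall s, lsub (V s);
  OIsubP : forall r s (a : lin_hom r s) (v : V r),
    OIsub_lsub r v -> OIsub_lsub s (OIact a v)
}.

Definition finitely_generated (V : OImod) : Prop :=
  exists gens : seq {s : nat & V s}, forall W : OIsub V,
    (forall x, x \in gens -> W (tag x) (tagged x)) -> forall s v, W s v.

Section SubmoduleModule.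
Variables (V : OImod) (W : OIsub V).

Definition sub_act r s (a : lin_hom r s) (v : sub_lmodType (W r)) :
    sub_lmodType (W s) :=
  in_sub (OIsubP a (sub_lmodP v)).

Lemma sub_act_linl r s (v : sub_lmodType (W r)) :
  linear (fun a : lin_hom r s => sub_act a v).
Proof. by move=> c a b; apply: val_inj; rewrite /= OIact_linl. Qed.

Lemma sub_act_linr r s (a : lin_hom r s) : linear (sub_act a).
Proof. by move=> c v w; apply: val_inj; rewrite /= OIact_linr. Qed.

Lemma sub_act_id r (v : sub_lmodType (W r)) : sub_act (lin_id r) v = v.
Proof. by apply: val_inj; rewrite /= OIact_id. Qed.

Lemma sub_act_comp r s t (b : lin_hom s t) (a : lin_hom r s)
    (v : sub_lmodType (W r)) :
  sub_act (lin_comp b a) v = sub_act b (sub_act a v).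
Proof. by apply: val_inj; rewrite /= OIact_comp. Qed.

Definition submodule_module : OImod :=
  {| OIob := fun s => sub_lmodType (W s); OIact := sub_act;
     OIact_linl := sub_act_linl; OIact_linr := sub_act_linr;
     OIact_id := sub_act_id; OIact_comp := sub_act_comp |}.
End SubmoduleModule.

Definition OIlin (V : OImod) r s (a : lin_hom r s) : {linear V r -> V s} :=
  mk_linear (OIact_linr (o := V) a).

Section QuotientModule.
Variables (V : OImod) (W : OIsub V).

Definition quot_act r s (a : lin_hom r s) (v : quot_lmodType (W r)) :
    quot_lmodType (W s) :=
  lpi (W s) (OIact a (repr v)).

Lemma quot_actE r s (a : lin_hom r s) (v : V r) :
  quot_act a (lpi (W r) v) = lpi (W s) (OIact a v).
Proof.
apply/lpi_eq; rewrite -[OIact a _]/(OIlin V a _) -[OIact a v]/(OIlin V a v).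
by rewrite -linearB; apply: OIsubP; exact: lpi_repr.
Qed.

Lemma quot_act_linl r s (v : quot_lmodType (W r)) :
  linear (fun a : lin_hom r s => quot_act a v).
Proof. by move=> c a b; rewrite /quot_act OIact_linl lpi_is_linear. Qed.

Lemma quot_act_linr r s (a : lin_hom r s) : linear (quot_act a).
Proof.
move=> c v w; rewrite -(lpi_surj v) -(lpi_surj w).
by rewrite -lpi_is_linear !quot_actE OIact_linr lpi_is_linear.
Qed.

Lemma quot_act_id r (v : quot_lmodType (W r)) : quot_act (lin_id r) v = v.
Proof. by rewrite /quot_act OIact_id lpi_surj. Qed.

Lemma quot_act_comp r s t (b : lin_hom s t) (a : lin_hom r s)
    (v : quot_lmodType (W r)) :
  quot_act (lin_comp b a) v = quot_act b (quot_act a v).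
Proof. by rewrite -(lpi_surj v) !quot_actE OIact_comp. Qed.

Definition quotient_module : OImod :=
  {| OIob := fun s => quot_lmodType (W s); OIact := quot_act;
     OIact_linl := quot_act_linl; OIact_linr := quot_act_linr;
     OIact_id := quot_act_id; OIact_comp := quot_act_comp |}.
End QuotientModule.

Definition OIfull (V : OImod) : OIsub V :=
  {| OIsub_lsub := fun s => {| lsub_set := fun _ : V s => True;
       lsub0 := Logic.I; lsubP := fun _ _ _ _ _ => Logic.I |};
     OIsubP := fun _ _ _ _ _ => Logic.I |}.

Section KernelImage.
Variables (V W : OImod) (f : OIhom V W).

Lemma ker_linP s a x y : OIfun f s x = 0 -> OIfun f s y = 0 ->
  OIfun f s (a *: x + y) = 0.
Proof. by move=> fx fy; rewrite linearP fx fy scaler0 addr0. Qed.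

Lemma ker_actP r s (a : lin_hom r s) (v : V r) :
  OIfun f r v = 0 -> OIfun f s (OIact a v) = 0.
Proof. by move=> fv; rewrite OIfunP fv; exact: (linear0 (OIlin W a)). Qed.

Definition OIker : OIsub V :=
  {| OIsub_lsub := fun s => {| lsub_set := fun x => OIfun f s x = 0;
       lsub0 := linear0 (OIfun f s); lsubP := @ker_linP s |};
     OIsubP := ker_actP |}.

Lemma im_0P s : exists x, OIfun f s x = 0.
Proof. by exists 0; exact: linear0. Qed.

Lemma im_linP s (a : k) y y' :
  (exists x, OIfun f s x = y) -> (exists x, OIfun f s x = y') ->
  exists x, OIfun f s x = a *: y + y'.
Proof. by move=> [x <-] [x' <-]; exists (a *: x + x'); rewrite linearP. Qed.

Lemma im_actP r s (a : lin_hom r s) (y : W r) :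
  (exists x, OIfun f r x = y) -> exists x, OIfun f s x = OIact a y.
Proof. by move=> [x <-]; exists (OIact a x); rewrite OIfunP. Qed.

Definition OIim : OIsub W :=
  {| OIsub_lsub := fun s => {| lsub_set := fun y => exists x, OIfun f s x = y;
       lsub0 := im_0P s; lsubP := @im_linP s |};
     OIsubP := im_actP |}.

Variable B : OIsub W.

Lemma preim_0P s : B s (OIfun f s 0).
Proof. by rewrite linear0; exact: lsub0. Qed.

Lemma preim_linP s a x y : B s (OIfun f s x) -> B s (OIfun f s y) ->
  B s (OIfun f s (a *: x + y)).
Proof. by move=> Bx By; rewrite linearP; exact: lsubP. Qed.

Lemma preim_actP r s (a : lin_hom r s) (v : V r) :
  B r (OIfun f r v) -> B s (OIfun f s (OIact a v)).
Proof. by move=> Bv; rewrite OIfunP; exact: OIsubP. Qed.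

Definition OIpreim : OIsub V :=
  {| OIsub_lsub := fun s => {| lsub_set := fun x => B s (OIfun f s x);
       lsub0 := preim_0P s; lsubP := @preim_linP s |};
     OIsubP := preim_actP |}.
End KernelImage.

Lemma OIinclP (V : OImod) (W : OIsub V) r s (a : lin_hom r s)
    (v : submodule_module W r) :
  sub_val (W s) (OIact a v) = OIact a (sub_val (W r) v).
Proof. by []. Qed.

Definition OIincl (V : OImod) (W : OIsub V) : OIhom (submodule_module W) V :=
  {| OIfun := fun s => sub_val (W s) : {linear submodule_module W s -> V s};
     OIfunP := @OIinclP V W |}.

(* Z / (Z ∩ B) *)
Definition subquotient (V : OImod) (Z B : OIsub V) : OImod :=
  quotient_module (OIpreim (OIincl Z) B).

Lemma lin_hom_gt0 r s (a : lin_hom r s) : (s < r)%N -> a = 0.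
Proof.
move=> sr; apply/ffunP=> x; exfalso.
have := leq_card _ (@oi_fun_inj _ _ x).
by rewrite !card_ord leqNgt sr.
Qed.

(* The degree s part of mV: sums of elements a v with a in C(r, s), r < s. *)
Inductive mmul_set (V : OImod) (s : nat) : V s -> Prop :=
| mmul_0 : mmul_set 0
| mmul_D x y : mmul_set x -> mmul_set y -> mmul_set (x + y)
| mmul_act r (a : lin_hom r s) (v : V r) : (r < s)%N -> mmul_set (OIact a v).

Lemma mmul_linP (V : OImod) s (c : k) (x y : V s) :
  mmul_set x -> mmul_set y -> mmul_set (c *: x + y).
Proof.
move=> hx hy; apply: mmul_D => //.
elim: hx => [|x1 x2 _ h1 _ h2|r a v rs].
- by rewrite scaler0; exact: mmul_0.
- by rewrite scalerDr; exact: mmul_D.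
rewrite -[OIact a v]/(mk_linear (OIact_linl v) a) -linearZ.
exact: mmul_act.
Qed.

Lemma mmul_actP (V : OImod) r s (a : lin_hom r s) (v : V r) :
  mmul_set v -> mmul_set (OIact a v).
Proof.
elim=> [|x1 x2 _ h1 _ h2|q b w qr].
- by rewrite -[OIact _ _]/(OIlin V a 0) linear0; exact: mmul_0.
- by rewrite -[OIact _ _]/(OIlin V a (x1 + x2)) linearD; exact: mmul_D.
rewrite -OIact_comp; have [rs|sr] := leqP r s.
  by apply: mmul_act; exact: leq_trans qr rs.
rewrite (lin_hom_gt0 a sr) OIact_comp.
by rewrite -[OIact 0 _]/(mk_linear (OIact_linl (OIact b w)) 0) linear0;
  exact: mmul_0.
Qed.

Definition mmul (V : OImod) : OIsub V :=
  {| OIsub_lsub := fun s => {| lsub_set := @mmul_set V s;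
       lsub0 := mmul_0 V s; lsubP := @mmul_linP V s |};
     OIsubP := @mmul_actP V |}.

Lemma mmul_hom (V W : OImod) (f : OIhom V W) s (v : V s) :
  mmul V s v -> mmul W s (OIfun f s v).
Proof.
elim=> [|x y _ hx _ hy|r a w rs]; first by rewrite linear0; exact: mmul_0.
  by rewrite linearD; exact: mmul_D.
by rewrite OIfunP; exact: mmul_act.
Qed.

Definition H0 (V : OImod) : OImod := quotient_module (mmul V).

Section H0Map.
Variables (V W : OImod) (f : OIhom V W).

Definition H0_fun s (q : H0 V s) : H0 W s := lpi (mmul W s) (OIfun f s (repr q)).

Lemma H0_funE s (v : V s) :
  H0_fun (lpi (mmul V s) v : H0 V s) = lpi (mmul W s) (OIfun f s v).
Proof. by apply/lpi_eq; rewrite -linearB; apply: mmul_hom; exact: lpi_repr. Qed.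

Lemma H0_fun_linear s : linear (@H0_fun s).
Proof.
move=> a p q; rewrite -(lpi_surj p) -(lpi_surj q).
by rewrite -lpi_is_linear !H0_funE linearP lpi_is_linear.
Qed.

Lemma H0_funP r s (a : lin_hom r s) (q : H0 V r) :
  mk_linear (@H0_fun_linear s) (OIact a q) =
  OIact a (mk_linear (@H0_fun_linear r) q).
Proof.
change (H0_fun (quot_act a q : H0 V s) = quot_act a (H0_fun q)).
by rewrite -(lpi_surj q) quot_actE !H0_funE quot_actE OIfunP.
Qed.

Definition H0_map : OIhom (H0 V) (H0 W) :=
  {| OIfun := fun s => mk_linear (@H0_fun_linear s); OIfunP := H0_funP |}.
End H0Map.

Definition surjective_hom (V W : OImod) (f : OIhom V W) : Prop :=
  forall s y, exists x, OIfun f s x = y.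

Definition projective (P : OImod) : Prop :=
  forall (A B : OImod) (e : OIhom A B) (f : OIhom P B), surjective_hom e ->
    exists g : OIhom P A, forall s x, OIfun e s (OIfun g s x) = OIfun f s x.

Record proj_resolution (V : OImod) := {
  res_mod :> nat -> OImod;
  res_d : forall i, OIhom (res_mod i.+1) (res_mod i);
  res_aug : OIhom (res_mod 0) V;
  res_projective : forall i, projective (res_mod i);
  res_aug_surj : surjective_hom res_aug;
  res_aug_exact : forall s x, OIker res_aug s x <-> OIim (res_d 0) s x;
  res_d_exact : forall i s x, OIker (res_d i) s x <-> OIim (res_d i.+1) s x
}.

Section DerivedFunctor.
Variables (V : OImod) (P : proj_resolution V).

Definition H0_cycles (i : nat) : OIsub (H0 (P i)) :=
  if i is j.+1 then OIker (H0_map (res_d P j)) else OIfull (H0 (P 0)).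

Definition H0_boundaries (i : nat) : OIsub (H0 (P i)) :=
  OIim (H0_map (res_d P i)).

(* The i-th homology of the complex H0 (P i.+1) -> H0 (P i) -> ... -> 0. *)
Definition H0_derived (i : nat) : OImod :=
  subquotient (H0_cycles i) (H0_boundaries i).
End DerivedFunctor.

(* The canonical resolution of V: cover V by the direct sum of the free modules
   C(r, -), one for each element v of each V_r, then repeat with the kernel. *)

Definition free1 (r : nat) : OImod :=
  {| OIob := lin_hom_lmodType r;
     OIact := fun s t b a => lin_comp b a;
     OIact_linl := fun s t a => @lin_comp_linl r s t a;
     OIact_linr := fun s t b => @lin_comp_linr r s t b;
     OIact_id := fun s a => @lin_comp1l r s a;
     OIact_comp := fun s t u c b a => esym (lin_compA c b a) |}.

Lemma free1_homP (V : OImod) r (v : V r) s t (b : lin_hom s t) (a : free1 r s) :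
  mk_linear (OIact_linl (s := t) v) (OIact b a) =
  OIact b (mk_linear (OIact_linl (s := s) v) a).
Proof. exact: OIact_comp. Qed.

Definition free1_hom (V : OImod) r (v : V r) : OIhom (free1 r) V :=
  {| OIfun := fun s => mk_linear (OIact_linl (s := s) v) : {linear free1 r s -> V s};
     OIfunP := @free1_homP V r v |}.

Section DirectSumModule.
Variables (I : choiceType) (M : I -> OImod).

Lemma dsum_act_proof r s (a : lin_hom r s) (x : dsum (fun i => M i r)) :
  fin_supp (fun i => OIact a (x i)).
Proof.
case: (dsumP x) => t ht; exists t => i /ht->; exact: (linear0 (OIlin (M i) a)).
Qed.

Definition dsum_act r s (a : lin_hom r s) (x : dsum_lmodType (fun i => M i r)) :
    dsum_lmodType (fun i => M i s) :=
  DSum (dsum_act_proof a x).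

Lemma dsum_act_linl r s (x : dsum_lmodType (fun i => M i r)) :
  linear (fun a : lin_hom r s => dsum_act a x).
Proof. by move=> c a b; apply: dsum_ext => i; rewrite /= OIact_linl. Qed.

Lemma dsum_act_linr r s (a : lin_hom r s) : linear (dsum_act a).
Proof. by move=> c v w; apply: dsum_ext => i; rewrite /= OIact_linr. Qed.

Lemma dsum_act_id r (x : dsum_lmodType (fun i => M i r)) :
  dsum_act (lin_id r) x = x.
Proof. by apply: dsum_ext => i; rewrite /= OIact_id. Qed.

Lemma dsum_act_comp r s t (b : lin_hom s t) (a : lin_hom r s)
    (x : dsum_lmodType (fun i => M i r)) :
  dsum_act (lin_comp b a) x = dsum_act b (dsum_act a x).
Proof. by apply: dsum_ext => i; rewrite /= OIact_comp. Qed.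

Definition dsum_module : OImod :=
  {| OIob := fun s => dsum_lmodType (fun i => M i s); OIact := dsum_act;
     OIact_linl := dsum_act_linl; OIact_linr := dsum_act_linr;
     OIact_id := dsum_act_id; OIact_comp := dsum_act_comp |}.

Section DirectSumHom.
Variables (N : OImod) (f : forall i, OIhom (M i) N).

Definition dsum_hom_fun s : {linear dsum_module s -> N s} :=
  mk_linear (dsum_rec_linear (fun i => OIfun (f i) s)).

Lemma dsum_homP r s (a : lin_hom r s) (x : dsum_module r) :
  dsum_hom_fun s (OIact a x) = OIact a (dsum_hom_fun r x).
Proof.
case: (dsum_support x x) => t [ut ht _] /=.
rewrite (@dsum_recE _ _ _ _ _ x t) // (@dsum_recE _ _ _ _ _ _ t) //; last first.
  by move=> i /ht /= ->; exact: (linear0 (OIlin (M i) a)).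
rewrite -[RHS]/(OIlin N a _) linear_sum; apply: eq_bigr => i _.
by rewrite OIfunP.
Qed.

Definition dsum_hom : OIhom dsum_module N :=
  {| OIfun := dsum_hom_fun; OIfunP := dsum_homP |}.
End DirectSumHom.

Definition dsum_inj i r (x : M i r) : dsum_module r :=
  @dinj k I (fun j => M j r) i x.

Lemma dsum_inj_act r s (a : lin_hom r s) i (x : M i r) :
  OIact a (dsum_inj x) = dsum_inj (OIact a x).
Proof.
apply: dsum_ext => j; rewrite /dsum_inj.
rewrite -[LHS]/(OIact a (@dinj k I (fun j => M j r) i x j)).
have [<-|ij] := eqVneq i j; first by rewrite !dinj_same.
by rewrite !dinj_diff //; exact: (linear0 (OIlin (M j) a)).
Qed.
End DirectSumModule.

Lemma free_projective (I : choiceType) (deg : I -> nat) :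
  projective (dsum_module (fun i => free1 (deg i))).
Proof.
set M := fun i => free1 (deg i) => A B e f se.
pose gen i : dsum_module M (deg i) := dsum_inj (lin_id (deg i) : M i (deg i)).
pose w i := projT1 (cid (se (deg i) (OIfun f _ (gen i)))).
have wP i : OIfun e _ (w i) = OIfun f _ (gen i) by rewrite /w; case: cid.
exists (dsum_hom (fun i => free1_hom (w i))) => s x.
case: (dsum_support x x) => t [ut ht _].
rewrite -[OIfun (dsum_hom _) s x]/(dsum_rec _ x) (dsum_recE _ ut ht).
rewrite [in RHS](dsum_decomp ut ht) !linear_sum.
apply: eq_bigr => i _.
rewrite -[OIfun (free1_hom _) s _]/(OIact (x i : lin_hom _ _) (w i)).
rewrite OIfunP wP -OIfunP dsum_inj_act; congr (OIfun f s (dinj _)).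
exact: lin_comp1r.
Qed.

Definition cover_index (V : OImod) : choiceType :=
  Choice.clone {r : nat & V r} _.

Definition free_cover (V : OImod) : OImod :=
  dsum_module (fun i : cover_index V => free1 (tag i)).

Definition cover_map (V : OImod) : OIhom (free_cover V) V :=
  dsum_hom (fun i : cover_index V => free1_hom (tagged i)).

Lemma cover_map_surj (V : OImod) : surjective_hom (cover_map V).
Proof.
move=> s v; pose i : cover_index V := Tagged (fun r => V r) v.
exists (@dinj _ _ _ i (lin_id s)).
by rewrite [LHS]dsum_rec_inj /= OIact_id.
Qed.

Lemma OIcompP (U V W : OImod) (g : OIhom V W) (f : OIhom U V) r s
    (a : lin_hom r s) (v : U r) :
  OIfun g s (OIfun f s (OIact a v)) = OIact a (OIfun g r (OIfun f r v)).
Proof. by rewrite !OIfunP. Qed.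

Definition OIcomp (U V W : OImod) (g : OIhom V W) (f : OIhom U V) : OIhom U W :=
  {| OIfun := fun s => (OIfun g s \o OIfun f s : {linear U s -> W s});
     OIfunP := @OIcompP U V W g f |}.

Lemma OIcompE (U V W : OImod) (g : OIhom V W) (f : OIhom U V) s (x : U s) :
  OIfun (OIcomp g f) s x = OIfun g s (OIfun f s x).
Proof. by []. Qed.

Fixpoint syzygy (V : OImod) (i : nat) : OImod :=
  if i is j.+1 then submodule_module (OIker (cover_map (syzygy V j))) else V.

Definition std_d (V : OImod) i :
    OIhom (free_cover (syzygy V i.+1)) (free_cover (syzygy V i)) :=
  OIcomp (OIincl (OIker (cover_map (syzygy V i)))) (cover_map (syzygy V i.+1)).

Lemma std_d_exact (V : OImod) i s x :
  OIker (cover_map (syzygy V i)) s x <-> OIim (std_d V i) s x.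
Proof.
split=> [kx|[y <-]]; last first.
  by rewrite OIcompE; exact: (sub_lmodP (OIfun (cover_map (syzygy V i.+1)) s y)).
have [y yx] := cover_map_surj (V := syzygy V i.+1) (in_sub kx).
by exists y; rewrite OIcompE yx.
Qed.

Lemma std_d_exact2 (V : OImod) i s x :
  OIker (std_d V i) s x <-> OIim (std_d V i.+1) s x.
Proof.
rewrite -std_d_exact; split=> [dx|kx]; first exact: val_inj.
suff : OIfun (std_d V i) s x = 0 by [].
by rewrite OIcompE kx linear0.
Qed.

Definition std_resolution (V : OImod) : proj_resolution V :=
  {| res_mod := fun i => free_cover (syzygy V i);
     res_d := std_d V;
     res_aug := cover_map V;
     res_projective := fun i =>
       @free_projective (cover_index (syzygy V i)) (fun j => tag j);
     res_aug_surj := @cover_map_surj V;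
     res_aug_exact := @std_d_exact V 0;
     res_d_exact := std_d_exact2 (V := V) |}.

(* Tor_i(C/m, V), the i-th left derived functor of H_0 (V |-> V/mV). As usual it
   is computed with one fixed projective resolution, any two of which give
   isomorphic homology. *)
Definition OI_Tor (i : nat) (V : OImod) : OImod := H0_derived (std_resolution V) i.

(* [supremum x0 A] is x0 if A is empty, and otherwise the least upper bound of
   A, which exists for every A by [bar_int_supremumP] below. *)
Definition hd (i : nat) (V : OImod) : \bar int :=
  supremum (-1)%:E [set (s%:Z)%:E | s in [set s | exists x : OI_Tor i V s, x <> 0]].

Definition reg (V : OImod) : \bar int :=
  supremum -oo%E [set (hd i V - (i%:Z)%:E)%E | i in [set: nat]].

End Linearization.
End OIG.

Lemma bar_int_supremumP (x0 : \bar int) (A : set (\bar int)) :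
  A !=set0 -> supremums A (supremum x0 A).
Proof.
move=> A0; rewrite /supremum; case: ifPn => [/eqP A_|_].
  by case: A0 => x; rewrite A_.
suff [y yA] : supremums A !=set0 by case: xgetP => [z _ //|/(_ y)].
have [AN|] := pselect (A `<=` [set -oo%E]).
  by exists -oo%E; split=> [x /AN ->//|y _]; exact: leNye.
move=> /existsNP[a /not_implyP[Aa /= aN]].
have [[n An]|noub] := pselect (exists n : int, ubound A n%:E); last first.
  exists +oo%E; split=> [x _|[m| |] mA]; first exact: leey.
  - by case: noub; exists m.
  - by [].
  - by have := mA _ Aa; rewrite leeNy_eq => /eqP.
case: a Aa aN => [a Aa _|/An//|//].
have : exists d : nat, `[< ubound A (a + d%:Z)%:E >].
  exists `|n - a|%N; apply/asboolP => x /An xn; apply: le_trans xn _.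
  by rewrite lee_fin; lia.
move=> ex; case: (ex_minnP ex) => d /asboolP dA dmin.
exists (a + d%:Z)%:E; split=> // -[m| |] mA; last 2 first.
- exact: leey.
- by have := mA _ Aa; rewrite leeNy_eq.
have am : a <= m by rewrite -lee_fin; exact: mA.
have : (d <= `|m - a|)%N.
  apply: dmin; apply/asboolP => x /mA; have -> : a + `|m - a|%N%:Z = m by lia.
  by [].
by rewrite lee_fin => ?; lia.
Qed.

(* Main.v *)
Require Import Defs.
From HB Require Import structures.
From mathcomp Require Import all_boot all_order all_algebra all_fingroup.
From mathcomp Require Import boolp classical_sets constructive_ereal zify.

Set Implicit Arguments.
Unset Strict Implicit.
Unset Printing Implicit Defensive.

Import Order.TTheory GRing.Theory Num.Theory.
Local Open Scope ring_scope.

(** Write M(d) for the free module C(d, -).  The idea is to embed OI_G in itself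
by adding a new least element to every object.  Restricting a module V along
this embedding gives the shifted module, with (shift V) s = V s.+1, and there
is a natural map V -> shift V induced by the inclusions of [s] onto the last s
elements of [s+1].

The category is Koszul: Tor_i(V)_s is the i-th homology of a cube-shaped
complex, the sum of one copy of V_#|S| for each subset S of [s].  Splitting the
subsets of [s+1] according to whether they contain the least element shows that
the cube of V at s+1 is the mapping cone of the map from the cube of V at s to
the cube of shift V at s.  This recursion is taken as the definition ([cube]).
For the present purpose it is enough that the vanishing of its homology implies
the vanishing of Tor ([Tor_vanish]): the cube turns short exact sequences into
long ones, and is acyclic in positive degree on free modules
([vanish_free1]), so one can shift dimensions along the resolution.

The cone gives two transfer principles for [reg_le N V], which says that
the homology of the cubes of V vanishes above the line s = N + i:
- the regularity of V exceeds that of shift V by at most one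
  ([reg_le_unshift]);
- if p retracts shift V onto V, the regularity of V exceeds that of ker p by
  at most one ([reg_le_retract]).

A morphism d -> s+1 either misses the least element, and then is a morphism
d -> s, or takes 1 to it with some label g in G, and then is determined by g and
a morphism d-1 -> s.  Hence shift M(d) is M(d) + M(d-1)^G, with a retraction p
onto M(d) (and shift M(0) = M(0)).  By induction on d, every submodule W of M(d)
has finite regularity ([bounded_free]).  Put W' = p(shift W), which contains W.  The kernel of
shift W -> W' lies in M(d-1)^G, so it has finite regularity; therefore, if W'
has finite regularity, so have shift W and W ([truncate_bounded]).  The chain W,
W', W'', ... has a union U with U' = U, so that p retracts shift U onto U with
kernel inside M(d-1)^G, and U has finite regularity
([saturated_bounded]).  In particular U is generated in finitely many degrees,
in each of which the chain stabilizes because k is Noetherian.  So the chain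
reaches U ([saturation_reached]), and one descends along it back to W.

Having all submodules of finite regularity passes to extensions, hence holds
for finite sums of free modules; a finitely generated V is the quotient of such
a sum by a submodule, and the long exact sequence concludes. *)

(** * Morphisms and the least element *)

Section LeastElement.
Variable G : finGroupType.

Lemma oi_fun_lt r s (x : oi_hom G r s) (i j : 'I_r) :
  (i < j)%N -> (oi_fun x i < oi_fun x j)%N.
Proof. by have /forallP/(_ i)/forallP/(_ j)/implyP := oi_pairP x. Qed.

Lemma oi_raiseP r s (x : oi_hom G r s) :
  oi_increasing [ffun i => lift ord0 (oi_fun x i)].
Proof.
apply/forallP=> i; apply/forallP=> j; apply/implyP=> ij.
by rewrite !ffunE !lift0 ltnS oi_fun_lt.
Qed.

Definition oi_raise r s (x : oi_hom G r s) : oi_hom G r s.+1 :=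
  @OIHom G r s.+1 ([ffun i => lift ord0 (oi_fun x i)], oi_lab x) (oi_raiseP x).

Lemma oi_consP r s (x : oi_hom G r s) :
  oi_increasing [ffun i : 'I_r.+1 =>
    oapp (fun j => lift ord0 (oi_fun x j)) ord0 (unlift ord0 i)].
Proof.
apply/forallP=> i; apply/forallP=> j; apply/implyP; rewrite !ffunE.
case: (unliftP ord0 j) => [j' ->|->] //; case: (unliftP ord0 i) => [i' ->|->] //.
by rewrite /= /bump !add1n !ltnS; exact: oi_fun_lt.
Qed.

(** For g = 1 this is the action on morphisms of the self-embedding of OI_G that
adds a least element. *)
Definition oi_cons r s (g : G) (x : oi_hom G r s) : oi_hom G r.+1 s.+1 :=
  @OIHom G r.+1 s.+1
    ([ffun i => oapp (fun j => lift ord0 (oi_fun x j)) ord0 (unlift ord0 i)],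
     [ffun i => oapp (oi_lab x) g (unlift ord0 i)]) (oi_consP x).

Lemma oi_raiseE r s (x : oi_hom G r s) i :
  oi_fun (oi_raise x) i = lift ord0 (oi_fun x i).
Proof. by rewrite /oi_fun ffunE. Qed.

Lemma oi_cons_fun0 r s g (x : oi_hom G r s) : oi_fun (oi_cons g x) ord0 = ord0.
Proof. by rewrite /oi_fun ffunE unlift_none. Qed.

Lemma oi_cons_funS r s g (x : oi_hom G r s) i :
  oi_fun (oi_cons g x) (lift ord0 i) = lift ord0 (oi_fun x i).
Proof. by rewrite /oi_fun ffunE liftK. Qed.

Lemma oi_cons_lab0 r s g (x : oi_hom G r s) : oi_lab (oi_cons g x) ord0 = g.
Proof. by rewrite /oi_lab ffunE unlift_none. Qed.

Lemma oi_cons_labS r s g (x : oi_hom G r s) i :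
  oi_lab (oi_cons g x) (lift ord0 i) = oi_lab x i.
Proof. by rewrite /oi_lab ffunE liftK. Qed.

Lemma oi_comp_fun r s t (y : oi_hom G s t) (x : oi_hom G r s) i :
  oi_fun (oi_comp y x) i = oi_fun y (oi_fun x i).
Proof. by rewrite /oi_fun ffunE. Qed.

Lemma oi_comp_lab r s t (y : oi_hom G s t) (x : oi_hom G r s) i :
  oi_lab (oi_comp y x) i = (oi_lab y (oi_fun x i) * oi_lab x i)%g.
Proof. by rewrite /oi_lab ffunE. Qed.

Lemma oi_comp_raise_l r s t (y : oi_hom G s t) (x : oi_hom G r s) :
  oi_comp (oi_raise y) x = oi_raise (oi_comp y x).
Proof.
apply: oi_homP => i; first by rewrite oi_raiseE !oi_comp_fun oi_raiseE.
by rewrite [RHS]oi_comp_lab oi_comp_lab.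
Qed.

Lemma oi_comp_cons_raise r s t h (y : oi_hom G s t) (x : oi_hom G r s) :
  oi_comp (oi_cons h y) (oi_raise x) = oi_raise (oi_comp y x).
Proof.
apply: oi_homP => i.
  by rewrite oi_raiseE !oi_comp_fun oi_raiseE oi_cons_funS.
by rewrite [RHS]oi_comp_lab oi_comp_lab oi_raiseE oi_cons_labS.
Qed.

Lemma oi_comp_cons r s t h g (y : oi_hom G s t) (x : oi_hom G r s) :
  oi_comp (oi_cons h y) (oi_cons g x) = oi_cons (h * g)%g (oi_comp y x).
Proof.
apply: oi_homP => i; case: (unliftP ord0 i) => [j ->|->].
- by rewrite oi_comp_fun !oi_cons_funS oi_comp_fun.
- by rewrite oi_comp_fun !oi_cons_fun0.
- by rewrite oi_comp_lab oi_cons_funS !oi_cons_labS oi_comp_lab.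
- by rewrite oi_comp_lab oi_cons_fun0 !oi_cons_lab0.
Qed.

Lemma oi_cons_id r : oi_cons 1 (oi_id G r) = oi_id G r.+1.
Proof.
have idE n i : oi_fun (oi_id G n) i = i by rewrite /oi_fun ffunE.
have idL n i : oi_lab (oi_id G n) i = 1%g by rewrite /oi_lab ffunE.
apply: oi_homP => i; case: (unliftP ord0 i) => [j ->|->].
- by rewrite oi_cons_funS !idE.
- by rewrite oi_cons_fun0 idE.
- by rewrite oi_cons_labS !idL.
- by rewrite oi_cons_lab0 idL.
Qed.

Lemma oi_raise_inj r s : injective (@oi_raise r s).
Proof.
move=> x y xy; apply: oi_homP => i.
  by apply: (@lift_inj _ ord0); rewrite -!oi_raiseE xy.
by rewrite -[oi_lab x]/(oi_lab (oi_raise x)) xy.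
Qed.

Lemma oi_cons_inj r s g : injective (@oi_cons r s g).
Proof.
move=> x y xy; apply: oi_homP => i; last by rewrite -(oi_cons_labS g x) xy oi_cons_labS.
by apply: (@lift_inj _ ord0); rewrite -!(oi_cons_funS g) xy.
Qed.

Lemma oi_cons_lab_inj r s g h (x y : oi_hom G r s) :
  oi_cons g x = oi_cons h y -> g = h.
Proof. by move=> e; rewrite -(oi_cons_lab0 g x) e oi_cons_lab0. Qed.

Lemma oi_cons_neq_raise r s g (x : oi_hom G r s) (y : oi_hom G r.+1 s) :
  oi_cons g x != oi_raise y.
Proof.
apply/eqP => e; have := oi_cons_fun0 g x; rewrite e oi_raiseE => /eqP.
by rewrite eq_sym (negPf (neq_lift _ _)).
Qed.

Lemma oi_fun_positive n s (h : 'I_n -> 'I_s.+1) : (forall i, (0 < h i)%N) ->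
  exists h' : 'I_n -> 'I_s, forall i, h i = lift ord0 (h' i).
Proof.
move=> h0; suff : forall i, exists j : 'I_s, h i = lift ord0 j.
  by move=> /fin_all_exists.
by move=> i; case: (unliftP ord0 (h i)) (h0 i) => [j ->|->] // _; exists j.
Qed.

Lemma oi_raise_onto r s (x : oi_hom G r s.+1) :
  (forall i, (0 < oi_fun x i)%N) -> exists x', x = oi_raise x'.
Proof.
move=> /oi_fun_positive[h hE].
have hP : oi_increasing [ffun i => h i].
  apply/forallP=> i; apply/forallP=> j; apply/implyP=> /(oi_fun_lt x).
  by rewrite !hE !ffunE !lift0.
exists (@OIHom G r s ([ffun i => h i], oi_lab x) hP).
by apply: oi_homP => i //; rewrite oi_raiseE hE /oi_fun /= ffunE.
Qed.

(** This dichotomy is what makes the shift of a free module a sum of free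
modules. *)
Lemma oi_leastP r s (x : oi_hom G r.+1 s.+1) :
  (exists x', x = oi_raise x') \/ (exists g x', x = oi_cons g x').
Proof.
have [x0|x0] := posnP (oi_fun x ord0); [right|left]; last first.
  apply: oi_raise_onto => i; case: (unliftP ord0 i) => [j ->|->] //.
  by apply: leq_ltn_trans (oi_fun_lt x (i := ord0) _).
have [|h hE] := @oi_fun_positive r s (fun i => oi_fun x (lift ord0 i)).
  by move=> i; apply: leq_ltn_trans (oi_fun_lt x (i := ord0) _).
have hP : oi_increasing [ffun i => h i].
  apply/forallP=> i; apply/forallP=> j; apply/implyP=> ij.
  have : (lift ord0 i < lift ord0 j)%N by rewrite !lift0.
  by move=> /(oi_fun_lt x); rewrite !hE !ffunE !lift0.
exists (oi_lab x ord0), (@OIHom G r s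
   ([ffun i => h i], [ffun i => oi_lab x (lift ord0 i)]) hP).
apply: oi_homP => i; case: (unliftP ord0 i) => [j ->|->].
- by rewrite oi_cons_funS hE /oi_fun /= ffunE.
- by apply: val_inj; rewrite oi_cons_fun0.
- by rewrite oi_cons_labS /oi_lab /= ffunE.
- by rewrite oi_cons_lab0.
Qed.
End LeastElement.

(** * The shift functor *)

Section Regularity.
Variables (G : finGroupType) (k : comPzRingType).
Local Notation OImod := (OImod G k).
Local Notation lin_hom := (@lin_hom G k).
Local Notation lin_base := (@lin_base G k _ _).
Implicit Types (U V W : OImod).

Section ChangeOfBasis.
Variables (r s r' s' : nat) (h : oi_hom G r s -> oi_hom G r' s').

Definition lin_push (a : lin_hom r s) : lin_hom r' s' :=
  \sum_x a x *: lin_base (h x).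

Definition lin_pull (a : lin_hom r' s') : lin_hom r s := [ffun x => a (h x)].

Lemma lin_push_linear : linear lin_push.
Proof.
move=> c a b; rewrite /lin_push scaler_sumr -big_split; apply: eq_bigr => x _.
by rewrite !ffunE scalerDl scalerA.
Qed.

Lemma lin_pull_linear : linear lin_pull.
Proof. by move=> c a b; apply/ffunP=> x; rewrite !ffunE. Qed.

Lemma lin_push_base x : lin_push (lin_base x) = lin_base (h x).
Proof.
rewrite /lin_push (bigD1 x) //= big1 ?addr0 => [|y /negPf yx].
  by rewrite ffunE eqxx scale1r.
by rewrite ffunE yx scale0r.
Qed.

Lemma lin_push_notin (a : lin_hom r s) z :
  (forall x, z != h x) -> lin_push a z = 0.
Proof.
move=> zh; rewrite sum_ffunE big1 // => x _.
by rewrite !ffunE (negPf (zh x)) scaler0.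
Qed.

Lemma lin_pull_base_notin z : (forall x, z != h x) -> lin_pull (lin_base z) = 0.
Proof.
by move=> zh; apply/ffunP=> x; rewrite !ffunE eq_sym (negPf (zh x)).
Qed.

Hypothesis hI : injective h.

Lemma lin_pull_base x : lin_pull (lin_base (h x)) = lin_base x.
Proof. by apply/ffunP=> y; rewrite !ffunE (inj_eq hI). Qed.

Lemma lin_pushE (a : lin_hom r s) x : lin_push a (h x) = a x.
Proof.
rewrite sum_ffunE (bigD1 x) //= big1 ?addr0 => [|y /negPf yx]; rewrite !ffunE.
  by rewrite eqxx /GRing.scale /= mulr1.
by rewrite (inj_eq hI) eq_sym yx scaler0.
Qed.
End ChangeOfBasis.

Definition lin_shift r s : lin_hom r s -> lin_hom r.+1 s.+1 :=
  lin_push (oi_cons 1%g).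

Lemma lin_shift_linear r s : linear (@lin_shift r s).
Proof. exact: lin_push_linear. Qed.

Lemma lin_shift_base r s (x : oi_hom G r s) :
  lin_shift (lin_base x) = lin_base (oi_cons 1%g x).
Proof. exact: lin_push_base. Qed.

Lemma lin_shift_id r : lin_shift (lin_id G k r) = lin_id G k r.+1.
Proof. by rewrite lin_shift_base oi_cons_id. Qed.

Lemma linear_compose (A B C : lmodType k) (f : B -> C) (g : A -> B) :
  linear f -> linear g -> linear (fun x => f (g x)).
Proof. by move=> lf lg a x y; rewrite lg lf. Qed.

Lemma lin_shift_comp r s t (b : lin_hom s t) (a : lin_hom r s) :
  lin_shift (lin_comp b a) = lin_comp (lin_shift b) (lin_shift a).
Proof.
move: a; apply: lin_homW.
- exact: linear_compose (@lin_shift_linear _ _) (@lin_comp_linr _ _ _ _ _ _).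
- exact: linear_compose (@lin_comp_linr _ _ _ _ _ _) (@lin_shift_linear _ _).
move=> x; move: b; apply: lin_homW.
- exact: linear_compose (@lin_shift_linear _ _) (@lin_comp_linl _ _ _ _ _ _).
- exact: linear_compose (@lin_comp_linl _ _ _ _ _ _) (@lin_shift_linear _ _).
by move=> y; rewrite !(lin_comp_base, lin_shift_base) oi_comp_cons mulg1.
Qed.

Section Shift.
Variable V : OImod.

Definition shift_act r s (a : lin_hom r s) (v : V r.+1) : V s.+1 :=
  OIact (lin_shift a) v.

Lemma shift_act_linl r s (v : V r.+1) : linear (fun a : lin_hom r s => shift_act a v).
Proof. exact: linear_compose (OIact_linl _) (@lin_shift_linear _ _). Qed.

Lemma shift_act_linr r s (a : lin_hom r s) : linear (shift_act a).
Proof. exact: OIact_linr. Qed.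

Lemma shift_act_id r (v : V r.+1) : shift_act (lin_id G k r) v = v.
Proof. by rewrite /shift_act lin_shift_id OIact_id. Qed.

Lemma shift_act_comp r s t (b : lin_hom s t) (a : lin_hom r s) (v : V r.+1) :
  shift_act (lin_comp b a) v = shift_act b (shift_act a v).
Proof. by rewrite /shift_act lin_shift_comp OIact_comp. Qed.

Definition shift : OImod :=
  {| OIob := fun s => V s.+1; OIact := shift_act; OIact_linl := shift_act_linl;
     OIact_linr := shift_act_linr; OIact_id := shift_act_id;
     OIact_comp := shift_act_comp |}.

Definition lin_raise r : lin_hom r r.+1 := lin_base (oi_raise (oi_id G r)).

Lemma lin_comp_raise r s (x : oi_hom G r s) :
  lin_comp (lin_raise s) (lin_base x) = lin_base (oi_raise x).
Proof. by rewrite lin_comp_base oi_comp_raise_l oi_comp1l. Qed.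

Lemma lin_raiseP r s (a : lin_hom r s) :
  lin_comp (lin_raise s) a = lin_comp (lin_shift a) (lin_raise r).
Proof.
move: a; apply: lin_homW.
- exact: lin_comp_linr.
- exact: linear_compose (@lin_comp_linl _ _ _ _ _ _) (@lin_shift_linear _ _).
move=> x; rewrite lin_comp_raise lin_shift_base lin_comp_base.
by rewrite oi_comp_cons_raise oi_comp1r.
Qed.

Lemma to_shiftP r s (a : lin_hom r s) (v : V r) :
  OIlin V (lin_raise s) (OIact a v) = shift_act a (OIlin V (lin_raise r) v).
Proof. by rewrite /= /shift_act -!OIact_comp lin_raiseP. Qed.

Definition to_shift : OIhom V shift :=
  {| OIfun := fun s => OIlin V (lin_raise s) : {linear V s -> shift s};
     OIfunP := to_shiftP |}.
End Shift.

Lemma shift_mapP V W (f : OIhom V W) r s (a : lin_hom r s) (v : shift V r) :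
  OIfun f s.+1 (OIact a v) = OIact (o := shift W) a (OIfun f r.+1 v).
Proof. exact: OIfunP. Qed.

Definition shift_map V W (f : OIhom V W) : OIhom (shift V) (shift W) :=
  {| OIfun := fun s => OIfun f s.+1 : {linear shift V s -> shift W s};
     OIfunP := shift_mapP f |}.

(** * The Koszul complex as an iterated mapping cone *)

(** Unfolded, the sum over all subsets S of [s] of V #|S|: the first component
collects the S that contain the least element, the second the others.  Keeping
the total object, with the homological grading as a predicate ([homog]), avoids
a family of modules indexed by two numbers. *)
Fixpoint cube s V : lmodType k :=
  if s is s'.+1 then (cube s' (shift V) * cube s' V)%type else V 0%N.

Fixpoint cube_map s V W (f : OIhom V W) : cube s V -> cube s W :=
  if s is s'.+1 then fun x => (cube_map (shift_map f) x.1, cube_map f x.2)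
  else OIfun f 0.

Lemma cube_map_linear s V W (f : OIhom V W) : linear (@cube_map s V W f).
Proof.
elim: s V W f => [|s IHs] V W f a x y /=; first exact: linearP.
by rewrite !IHs.
Qed.

HB.instance Definition _ s V W (f : OIhom V W) :=
  GRing.isLinear.Build k (cube s V) (cube s W) *:%R (@cube_map s V W f)
    (cube_map_linear f).

Fixpoint cube_d s V : cube s V -> cube s V :=
  if s is s'.+1 then
    fun x => (cube_d x.1 + cube_map (to_shift V) x.2, - cube_d x.2)
  else fun=> 0.

Lemma cube_d_linear s V : linear (@cube_d s V).
Proof.
elim: s V => [|s IHs] V a x y /=; first by rewrite scaler0 addr0.
congr pair; last by rewrite /= IHs opprD scalerN.
by rewrite /= IHs linearP scalerDr addrACA.
Qed.

HB.instance Definition _ s V :=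
  GRing.isLinear.Build k (cube s V) (cube s V) *:%R (@cube_d s V) (@cube_d_linear s V).

(** The i-th chain group: the summands of the subsets S with i elements missing.
At s = 0 only S empty remains, in degree 0. *)
Fixpoint homog s i V : cube s V -> Prop :=
  if s is s'.+1 then
    fun x => homog i x.1 /\ (if i is j.+1 then homog j x.2 else x.2 = 0)
  else fun x => (i = 0%N) \/ x = 0.


Lemma cube_map0 s V W (f : OIhom V W) : cube_map f (0 : cube s V) = 0.
Proof. exact: linear0. Qed.
Lemma cube_mapD s V W (f : OIhom V W) (x y : cube s V) :
  cube_map f (x + y) = cube_map f x + cube_map f y.
Proof. exact: linearD. Qed.
Lemma cube_mapN s V W (f : OIhom V W) (x : cube s V) :
  cube_map f (- x) = - cube_map f x.
Proof. exact: linearN. Qed.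
Lemma cube_mapB s V W (f : OIhom V W) (x y : cube s V) :
  cube_map f (x - y) = cube_map f x - cube_map f y.
Proof. exact: linearB. Qed.
Lemma cube_d0 s V : cube_d (0 : cube s V) = 0.
Proof. exact: linear0. Qed.
Lemma cube_dD s V (x y : cube s V) : cube_d (x + y) = cube_d x + cube_d y.
Proof. exact: linearD. Qed.
Lemma cube_dN s V (x : cube s V) : cube_d (- x) = - cube_d x.
Proof. exact: linearN. Qed.
Lemma cube_dB s V (x y : cube s V) : cube_d (x - y) = cube_d x - cube_d y.
Proof. exact: linearB. Qed.

Lemma cube_map_comm s U V V' W (f : OIhom U V) (g : OIhom V W)
    (f' : OIhom U V') (g' : OIhom V' W) :
  (forall r x, OIfun g r (OIfun f r x) = OIfun g' r (OIfun f' r x)) ->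
  forall x : cube s U, cube_map g (cube_map f x) = cube_map g' (cube_map f' x).
Proof.
elim: s U V V' W f g f' g' => [|s IHs] U V V' W f g f' g' e x /=; first exact: e.
by congr pair; apply: IHs => r y; exact: e.
Qed.

Lemma cube_mapK s V W (f : OIhom V W) (g : OIhom W V) :
  (forall r, cancel (OIfun f r) (OIfun g r)) ->
  cancel (@cube_map s _ _ f) (cube_map g).
Proof.
elim: s V W f g => [|s IHs] V W f g e x /=; first exact: e.
by rewrite !IHs -?surjective_pairing // => r y; exact: e.
Qed.

Lemma cube_d_map s V W (f : OIhom V W) (x : cube s V) :
  cube_d (cube_map f x) = cube_map f (cube_d x).
Proof.
elim: s V W f x => [|s IHs] V W f x /=; first by rewrite linear0.
congr pair; last by rewrite /= IHs -linearN.
rewrite /= IHs linearD; congr (_ + _).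
by apply: cube_map_comm => r y; rewrite /= -OIfunP.
Qed.

Lemma cube_dd s V (x : cube s V) : cube_d (cube_d x) = 0.
Proof.
elim: s V x => [//|s IHs] V x /=.
congr pair; last by rewrite /= cube_dN opprK IHs.
by rewrite /= cube_dD cube_mapN -cube_d_map IHs add0r subrr.
Qed.

Lemma homog0 s i V : homog i (0 : cube s V).
Proof. by elim: s i V => [|s IHs] i V /=; [right|split => //; case: i]. Qed.

Lemma homogP s i V (a : k) (x y : cube s V) :
  homog i x -> homog i y -> homog i (a *: x + y).
Proof.
elim: s i V x y => [|s IHs] i V x y /=.
  by move=> [->|->]; [left|move=> [->|->]; [left|right; rewrite scaler0 addr0]].
move=> [x1 x2] [y1 y2]; split; first exact: IHs.
by case: i x2 y2 {x1 y1} => [/= -> ->|i]; [rewrite scaler0 addr0|exact: IHs].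
Qed.

Lemma homogD s i V (x y : cube s V) : homog i x -> homog i y -> homog i (x + y).
Proof. by move=> hx; rewrite -[x]scale1r; exact: homogP. Qed.

Lemma homogN s i V (x : cube s V) : homog i x -> homog i (- x).
Proof.
by move=> hx; rewrite -[- x]addr0 -scaleN1r; apply: homogP => //; exact: homog0.
Qed.

Lemma homogB s i V (x y : cube s V) : homog i x -> homog i y -> homog i (x - y).
Proof. by move=> hx hy; apply: homogD => //; exact: homogN. Qed.

Lemma homog_map s i V W (f : OIhom V W) (x : cube s V) :
  homog i x -> homog i (cube_map f x).
Proof.
elim: s i V W f x => [|s IHs] i V W f x /=.
  by case=> [->|->]; [left|right; exact: linear0].
case=> x1 x2; split; first exact: IHs.
by case: i x2 {x1} => [->|i]; [exact: cube_map0|exact: IHs].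
Qed.

Lemma cube_d_homog0 s V (x : cube s V) : homog 0 x -> cube_d x = 0.
Proof.
elim: s V x => [//|s IHs] V x /= [x1 ->].
by rewrite IHs // cube_map0 cube_d0 addr0 oppr0.
Qed.

Lemma homog_d s i V (x : cube s V) : homog i.+1 x -> homog i (cube_d x).
Proof.
elim: s i V x => [|s IHs] i V x /=; first by right.
case=> x1 x2; split; first by apply: homogD; [exact: IHs|exact: homog_map].
case: i x2 {x1} => [|i] x2; last by apply: homogN; exact: IHs.
by rewrite cube_d_homog0 // oppr0.
Qed.

Definition injective_hom V W (f : OIhom V W) := forall s, injective (OIfun f s).

Definition exact_hom U V W (f : OIhom U V) (g : OIhom V W) :=
  forall s y, OIfun g s y = 0 <-> exists x, OIfun f s x = y.

Lemma cube_map_inj s V W (f : OIhom V W) :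
  injective_hom f -> injective (@cube_map s _ _ f).
Proof.
elim: s V W f => [|s IHs] V W f fI; first exact: fI.
move=> [x1 x2] [y1 y2] /= [e1 e2]; congr pair; last exact: IHs e2.
by apply: (IHs _ _ (shift_map f)) e1 => r; exact: fI.
Qed.

Lemma homog_inj s i V W (f : OIhom V W) (x : cube s V) :
  injective_hom f -> homog i (cube_map f x) -> homog i x.
Proof.
elim: s i V W f x => [|s IHs] i V W f x fI /=.
  by case=> [->|]; [left|rewrite -(linear0 (OIfun f 0)) => /fI; right].
case=> /IHs h1 h2; split; first by apply: h1 => r; exact: fI.
case: i h2 {h1} => [|i]; last exact: IHs.
by rewrite -(cube_map0 s f) => /cube_map_inj; exact.
Qed.

Lemma cube_map_surj s i V W (f : OIhom V W) (y : cube s W) :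
  surjective_hom f -> homog i y -> exists2 x, homog i x & cube_map f x = y.
Proof.
elim: s i V W f y => [|s IHs] i V W f y fS /=.
  case=> [->|->]; last by exists 0; [right|exact: linear0].
  by have [x <-] := fS 0%N y; exists x; first by left.
case: y => y1 y2 /= [h1 h2].
have [x1 hx1 <-] := IHs _ _ _ (shift_map f) _ (fun r => fS r.+1) h1.
case: i h2 hx1 {h1} => [->|i /(IHs _ _ _ f _ fS)[x2 hx2 <-]] hx1.
  by exists (x1, 0) => //=; rewrite cube_map0.
by exists (x1, x2).
Qed.

Lemma cube_map_exact s U V W (f : OIhom U V) (g : OIhom V W) (y : cube s V) :
  exact_hom f g -> cube_map g y = 0 -> exists x, cube_map f x = y.
Proof.
elim: s U V W f g y => [|s IHs] U V W f g y fg /=; first by move/fg.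
case: y => y1 y2 /= [e1 e2].
have [x1 <-] := IHs _ _ _ (shift_map f) (shift_map g) _ (fun r => fg r.+1) e1.
by have [x2 <-] := IHs _ _ _ _ _ _ fg e2; exists (x1, x2).
Qed.

Lemma exact_comp0 s U V W (f : OIhom U V) (g : OIhom V W) (x : cube s U) :
  exact_hom f g -> cube_map g (cube_map f x) = 0.
Proof.
elim: s U V W f g x => [|s IHs] U V W f g x fg /=; first by apply/fg; exists x.
by rewrite (IHs _ _ _ f) // (IHs _ _ _ (shift_map f)) // => r y; exact: fg.
Qed.

(** The homology of the cube of V at s is zero in homological degree i. *)
Definition vanish i s V : Prop := forall x : cube s V,
  homog i x -> cube_d x = 0 -> exists2 y, homog i.+1 y & cube_d y = x.

(** The segments of the long exact homology sequence that are used, in terms of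
vanishing. *)
Section ShortExact.
Variables (A B C : OImod) (f : OIhom A B) (g : OIhom B C).
Hypotheses (fI : injective_hom f) (gS : surjective_hom g) (fg : exact_hom f g).

Lemma vanish_middle i s : vanish i s A -> vanish i s C -> vanish i s B.
Proof.
move=> vA vC x hx dx.
have [||z hz dz] := vC (cube_map g x); first exact: homog_map.
  by rewrite cube_d_map dx cube_map0.
have [w hw wz] := cube_map_surj gS hz.
have [|a fa] := cube_map_exact (y := x - cube_d w) fg.
  by rewrite cube_mapB -cube_d_map wz dz subrr.
have [||b hb db] := vA a.
- by apply: (homog_inj fI); rewrite fa; apply: homogB => //; exact: homog_d.
- by apply: (cube_map_inj fI); rewrite -cube_d_map fa cube_dB dx cube_dd subrr cube_map0.
exists (w + cube_map f b); first by apply: homogD => //; exact: homog_map.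
by rewrite cube_dD cube_d_map db fa addrC subrK.
Qed.

Lemma vanish_right0 s : vanish 0 s B -> vanish 0 s C.
Proof.
move=> vB c hc _; have [b hb bc] := cube_map_surj gS hc.
have [||e he de] := vB b => //; first exact: cube_d_homog0.
by exists (cube_map g e); [exact: homog_map|rewrite cube_d_map de].
Qed.

Lemma vanish_right i s : vanish i s A -> vanish i.+1 s B -> vanish i.+1 s C.
Proof.
move=> vA vB c hc dc; have [b hb bc] := cube_map_surj gS hc.
have [|a fa] := cube_map_exact (y := cube_d b) fg.
  by rewrite -cube_d_map bc.
have [||a' ha' da'] := vA a.
- by apply: (homog_inj fI); rewrite fa; exact: homog_d.
- by apply: (cube_map_inj fI); rewrite -cube_d_map fa cube_dd cube_map0.
have [||e he de] := vB (b - cube_map f a').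
- by apply: homogB => //; exact: homog_map.
- by rewrite cube_dB cube_d_map da' fa subrr.
exists (cube_map g e); first exact: homog_map.
by rewrite cube_d_map de cube_mapB bc (exact_comp0 _ fg) subr0.
Qed.

(** Exactness at H_i(A): a cycle of A that bounds in B bounds in A when
H_(i+1)(C) = 0. *)
Lemma vanish_boundary i s (a : cube s A) (y : cube s B) : vanish i.+1 s C ->
  homog i.+1 y -> cube_d y = cube_map f a ->
  exists2 y', homog i.+1 y' & cube_d y' = a.
Proof.
move=> vC hy dy; have [||z hz dz] := vC (cube_map g y); first exact: homog_map.
  by rewrite cube_d_map dy (exact_comp0 _ fg).
have [w hw wz] := cube_map_surj gS hz.
have [|a' fa'] := cube_map_exact (y := y - cube_d w) fg.
  by rewrite cube_mapB -cube_d_map wz dz subrr.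
exists a'.
  by apply: (homog_inj fI); rewrite fa'; apply: homogB => //; exact: homog_d.
by apply: (cube_map_inj fI); rewrite -cube_d_map fa' cube_dB cube_dd subr0.
Qed.

Lemma vanish_left i s : vanish i s B -> vanish i.+1 s C -> vanish i s A.
Proof.
move=> vB vC a ha da; have [||y hy dy] := vB (cube_map f a).
- exact: homog_map.
- by rewrite cube_d_map da cube_map0.
exact: vanish_boundary vC hy dy.
Qed.
End ShortExact.

Lemma ker_exact V W (f : OIhom V W) : exact_hom (OIincl (OIker f)) f.
Proof.
move=> s y; split=> [fy|[x <-]]; last exact: (sub_lmodP x).
by exists (in_sub (S := OIker f s) fy).
Qed.

Lemma incl_inj V (W : OIsub V) : injective_hom (OIincl W).
Proof. by move=> s x y /= xy; exact: val_inj. Qed.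

(** Applying p to a cycle (x1, x0) of the cone gives d(p x1) = - x0.  So
subtracting the boundary of (0, p x1) removes the second component and takes the
first into ker p.  In other words, the cone of a split injection is
equivalent to the complement. *)
Lemma vanish_retract i s V (p : OIhom (shift V) V) :
  (forall r, cancel (OIfun (to_shift V) r) (OIfun p r)) ->
  vanish i s (submodule_module (OIker p)) -> vanish i s.+1 V.
Proof.
move=> pK vK [x1 x0] /= [h1 h0] [d1 d0].
have pi x : cube_map p (cube_map (to_shift V) x) = x by exact: cube_mapK.
(* x' is the projection of x1 to ker p along the image of V. *)
pose x' := x1 - cube_map (to_shift V) (cube_map p x1).
have px' : cube_map p x' = 0 by rewrite cube_mapB pi subrr.
have [z zx'] := cube_map_exact (ker_exact p) px'.
have dp : cube_d (cube_map p x1) = - x0.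
  apply/eqP; rewrite -addr_eq0 -[X in _ + X]pi cube_d_map -cube_mapD d1.
  by rewrite cube_map0.
have [||w hw dw] := vK z.
- apply: (homog_inj (@incl_inj _ _)); rewrite zx'; apply: homogB => //.
  by do 2!apply: homog_map.
- apply: (cube_map_inj (@incl_inj _ _)); rewrite -cube_d_map zx' cube_map0 cube_dB.
  rewrite (cube_d_map (to_shift V)) dp cube_mapN opprK; exact: d1.
exists (cube_map (OIincl (OIker p)) w, cube_map p x1).
  by split; exact: homog_map.
by rewrite /= cube_d_map dw zx' subrK dp opprK.
Qed.

(** When V is the direct sum of the M j, so is its cube.  The hypothesis says this
through finite sums only, which covers both infinite direct sums and finite
ones; it asks for all t' beyond t since the two components of an element of the
cube have different supports. *)
Lemma cube_decomp s (I : eqType) V (M : I -> OImod) (p : forall j, OIhom V (M j))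
    (q : forall j, OIhom (M j) V) :
  (forall r (x : V r), exists t : seq I, forall t', uniq t' -> {subset t <= t'} ->
     x = \sum_(j <- t') OIfun (q j) r (OIfun (p j) r x)) ->
  forall x : cube s V, exists t : seq I, forall t', uniq t' -> {subset t <= t'} ->
     x = \sum_(j <- t') cube_map (q j) (cube_map (p j) x).
Proof.
elim: s V M p q => [|s IHs] V M p q pq x /=; first exact: pq.
case: x => x1 x2 /=.
have [t1 e1] : exists t : seq I, forall t', uniq t' -> {subset t <= t'} -> x1 =
    \sum_(j <- t') cube_map (shift_map (q j)) (cube_map (shift_map (p j)) x1).
  by apply: IHs => r y; exact: pq.
have [t2 e2] := IHs _ _ _ _ pq x2.
exists (t1 ++ t2) => t' ut' st'.
rewrite {1}(e1 t') // => [|j jt]; last by apply: st'; rewrite mem_cat jt.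
rewrite {1}(e2 t') // => [|j jt]; last by apply: st'; rewrite mem_cat jt orbT.
elim: t' {ut' st'} => [|j t' IHt]; first by rewrite !big_nil.
by rewrite !big_cons -IHt.
Qed.

Lemma vanish_decomp i s (I : eqType) V (M : I -> OImod)
    (p : forall j, OIhom V (M j)) (q : forall j, OIhom (M j) V) :
  (forall r (x : V r), exists t : seq I, forall t', uniq t' -> {subset t <= t'} ->
     x = \sum_(j <- t') OIfun (q j) r (OIfun (p j) r x)) ->
  (forall j, vanish i s (M j)) -> vanish i s V.
Proof.
move=> pq vM x hx dx; have [t xE] := cube_decomp pq x.
have yS j : {y : cube s (M j) | homog i.+1 y /\ cube_d y = cube_map (p j) x}.
  apply: cid; have [||y hy dy] := vM j (cube_map (p j) x); last by exists y.
    exact: homog_map.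
  by rewrite cube_d_map dx cube_map0.
exists (\sum_(j <- undup t) cube_map (q j) (sval (yS j))).
  elim/big_ind: _ => [|a b|j _]; [exact: homog0|exact: homogD|].
  by apply: homog_map; case: (svalP (yS j)).
rewrite [RHS](xE (undup t)) ?undup_uniq // => [|j]; last by rewrite mem_undup.
rewrite linear_sum; apply: eq_bigr => j _.
by rewrite /= cube_d_map; case: (svalP (yS j)) => _ ->.
Qed.

(** * Regularity and the shift *)
Definition reg_le N V := forall i s, (N + i < s)%N -> vanish i s V.

(** From the exact sequence H_i(shift V)_s -> H_i(V)_(s+1) -> H_(i-1)(V)_s of
the cone, by induction on i. *)
Lemma reg_le_unshift N V : reg_le N (shift V) -> reg_le N.+1 V.
Proof.
move=> vV i; elim: i => [|i IHi] [//|s] lt [x1 x0] /= [h1 h0] [d1 d0].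
  have ls : (N + 0 < s)%N by lia.
  have [e he de] : exists2 y, homog 1 y & cube_d y = x1.
    by apply: (vV _ _ ls) => //; move: d1; rewrite h0 cube_map0 addr0.
  exists (e, 0); first by split=> //; exact: homog0.
  by rewrite /= de h0 cube_map0 cube_d0 addr0 oppr0.
(* x0 bounds by induction; this reduces to a zero second component. *)
have ls : (N.+1 + i < s)%N by lia.
have ls' : (N + i.+1 < s)%N by lia.
have [w hw dw] : exists2 w, homog i.+1 w & cube_d w = x0.
  by apply: (IHi _ ls) => //; apply/eqP; rewrite -oppr_eq0 d0.
have [e he de] : exists2 y, homog i.+2 y &
    cube_d y = x1 + cube_map (to_shift V) w.
  apply: (vV _ _ ls'); first by apply: homogD => //; exact: homog_map.
  by rewrite cube_dD cube_d_map dw; exact: d1.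
exists (e, - w); first by split=> //; exact: homogN.
by rewrite /= de cube_mapN addrK cube_dN dw opprK.
Qed.

Lemma reg_le_retract N V (p : OIhom (shift V) V) :
  (forall r, cancel (OIfun (to_shift V) r) (OIfun p r)) ->
  reg_le N (submodule_module (OIker p)) -> reg_le N.+1 V.
Proof. by move=> pK vK i [//|s] lt; apply: (vanish_retract pK); exact: vK. Qed.


Local Notation free1 := (@free1 G k).

(** * Free modules *)

Lemma lin_pull_shift r r' s t (hs : oi_hom G r s -> oi_hom G r' s.+1)
    (ht : oi_hom G r t -> oi_hom G r' t.+1) :
  (forall y z, lin_pull ht (lin_base (oi_comp (oi_cons 1%g y) z)) =
               lin_comp (lin_base y) (lin_pull hs (lin_base z))) ->
  forall (b : lin_hom s t) a,
    lin_pull ht (lin_comp (lin_shift b) a) = lin_comp b (lin_pull hs a).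
Proof.
move=> hst b a; move: a; apply: lin_homW.
- exact: linear_compose (@lin_pull_linear _ _ _ _ _) (@lin_comp_linr _ _ _ _ _ _).
- exact: linear_compose (@lin_comp_linr _ _ _ _ _ _) (@lin_pull_linear _ _ _ _ _).
move=> z; move: b; apply: lin_homW.
- apply: linear_compose; first exact: lin_pull_linear.
  exact: linear_compose (@lin_comp_linl _ _ _ _ _ _) (@lin_shift_linear _ _).
- exact: lin_comp_linl.
by move=> y; rewrite lin_shift_base lin_comp_base hst.
Qed.

Lemma lin_comp0r r s t (b : lin_hom s t) : lin_comp b (0 : lin_hom r s) = 0.
Proof. exact: (linear0 (mk_linear (@lin_comp_linr G k r s t b))). Qed.

Lemma free_retractP r s t (b : lin_hom s t) (a : lin_hom r s.+1) :
  lin_pull (@oi_raise G r t) (lin_comp (lin_shift b) a) =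
  lin_comp b (lin_pull (@oi_raise G r s) a).
Proof.
move: b a; apply: lin_pull_shift => y z.
have raised x : lin_pull (@oi_raise G r t)
      (lin_base (oi_comp (oi_cons 1%g y) (oi_raise x))) =
    lin_comp (lin_base y) (lin_pull (@oi_raise G r s) (lin_base (oi_raise x))).
  by rewrite oi_comp_cons_raise !(lin_pull_base (@oi_raise_inj G _ _)) lin_comp_base.
case: r z raised => [|r] z raised.
  by have [|x ->] := @oi_raise_onto _ _ _ z; [case|exact: raised].
have [[x ->]|[g [x ->]]] := oi_leastP z; first exact: raised.
by rewrite oi_comp_cons !lin_pull_base_notin ?lin_comp0r // => u;
  exact: oi_cons_neq_raise.
Qed.

(** The projection of shift M(r) onto its summand M(r). *)
Definition free_retract r : OIhom (shift (free1 r)) (free1 r) :=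
  {| OIfun := fun s => mk_linear (@lin_pull_linear r s r s.+1 (@oi_raise G r s))
       : {linear shift (free1 r) s -> free1 r s};
     OIfunP := @free_retractP r |}.

Lemma free_retractK r s : cancel (OIfun (to_shift (free1 r)) s) (OIfun (free_retract r) s).
Proof.
apply: lin_homW => [||x].
- exact: linear_compose (@lin_pull_linear _ _ _ _ _) (@lin_comp_linr _ _ _ _ _ _).
- by [].
rewrite -[LHS]/(lin_pull _ (lin_comp (lin_raise s) (lin_base x))).
by rewrite lin_comp_raise lin_pull_base //; exact: oi_raise_inj.
Qed.

Lemma free_headP r g s t (b : lin_hom s t) (a : lin_hom r.+1 s.+1) :
  lin_pull (@oi_cons G r t g) (lin_comp (lin_shift b) a) =
  lin_comp b (lin_pull (@oi_cons G r s g) a).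
Proof.
move: b a; apply: lin_pull_shift => y z.
have [[x ->]|[h [x ->]]] := oi_leastP z.
  rewrite oi_comp_cons_raise !lin_pull_base_notin ?lin_comp0r // => u;
    by rewrite eq_sym oi_cons_neq_raise.
rewrite oi_comp_cons mul1g; have [<-|gh] := eqVneq g h.
  by rewrite !(lin_pull_base (@oi_cons_inj G _ _ _)) lin_comp_base.
by rewrite !lin_pull_base_notin ?lin_comp0r // => u; apply: contraNneq gh;
  move/oi_cons_lab_inj->.
Qed.

(** The coordinate of shift M(r+1) on the g-th copy of M(r). *)
Definition free_head r g : OIhom (shift (free1 r.+1)) (free1 r) :=
  {| OIfun := fun s => mk_linear (@lin_pull_linear r s r.+1 s.+1 (@oi_cons G r s g))
       : {linear shift (free1 r.+1) s -> free1 r s};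
     OIfunP := @free_headP r g |}.

Lemma free_graftP r g s t (b : lin_hom s t) (a : lin_hom r s) :
  lin_push (@oi_cons G r t g) (lin_comp b a) =
  lin_comp (lin_shift b) (lin_push (@oi_cons G r s g) a).
Proof.
move: a; apply: lin_homW.
- exact: linear_compose (@lin_push_linear _ _ _ _ _) (@lin_comp_linr _ _ _ _ _ _).
- exact: linear_compose (@lin_comp_linr _ _ _ _ _ _) (@lin_push_linear _ _ _ _ _).
move=> x; move: b; apply: lin_homW.
- exact: linear_compose (@lin_push_linear _ _ _ _ _) (@lin_comp_linl _ _ _ _ _ _).
- exact: linear_compose (@lin_comp_linl _ _ _ _ _ _) (@lin_shift_linear _ _).
by move=> y; rewrite !(lin_comp_base, lin_push_base, lin_shift_base) oi_comp_cons mul1g.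
Qed.

Definition free_graft r g : OIhom (free1 r) (shift (free1 r.+1)) :=
  {| OIfun := fun s => mk_linear (@lin_push_linear r s r.+1 s.+1 (@oi_cons G r s g))
       : {linear free1 r s -> shift (free1 r.+1) s};
     OIfunP := @free_graftP r g |}.

Lemma free_retract_graft r g s x :
  OIfun (free_retract r.+1) s (OIfun (free_graft r g) s x) = 0.
Proof.
apply/ffunP=> z; rewrite !ffunE; apply: lin_push_notin => u.
by rewrite eq_sym oi_cons_neq_raise.
Qed.

Lemma free_ker_decomp r s (x : shift (free1 r.+1) s) :
  OIfun (free_retract r.+1) s x = 0 ->
  x = \sum_(g : G) OIfun (free_graft r g) s (OIfun (free_head r g) s x).
Proof.
move=> x0; apply/ffunP=> z; rewrite sum_ffunE.
have [[u ->]|[h [u ->]]] := oi_leastP z.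
  have := congr1 (fun f : lin_hom r.+1 s => f u) x0; rewrite !ffunE => ->.
  rewrite big1 // => g _; apply: lin_push_notin => v.
  by rewrite eq_sym oi_cons_neq_raise.
rewrite (bigD1 h) //= big1 ?addr0 => [|g gh].
  by rewrite lin_pushE ?ffunE //; exact: oi_cons_inj.
by apply: lin_push_notin => v; apply: contraNneq gh => /oi_cons_lab_inj->.
Qed.

Section Corestriction.
Variables (U V : OImod) (W : OIsub V) (f : OIhom U V).
Hypothesis fW : forall s x, W s (OIfun f s x).

Definition corestr_fun s (x : U s) : submodule_module W s := in_sub (fW x).

Lemma corestr_linear s : linear (@corestr_fun s).
Proof. by move=> a x y; apply: val_inj; rewrite /= linearP. Qed.

Lemma corestrP r s (a : lin_hom r s) (x : U r) :
  mk_linear (@corestr_linear s) (OIact a x) =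
  OIact a (mk_linear (@corestr_linear r) x).
Proof. by apply: val_inj; rewrite /= OIfunP. Qed.

Definition corestr : OIhom U (submodule_module W) :=
  {| OIfun := fun s => mk_linear (@corestr_linear s); OIfunP := corestrP |}.
End Corestriction.

Lemma vanish_zero i s V : (forall r (x : V r), x = 0) -> vanish i s V.
Proof.
move=> V0 x _ _; exists 0; first exact: homog0.
rewrite cube_d0; elim: s V V0 x => [|s IHs] V V0 x; first by rewrite [RHS]V0.
by case: x => x y; congr pair; apply: IHs => // r z; exact: V0.
Qed.

(** By [vanish_retract], the homology of M(r) at s+1 is that of the complement
M(r-1)^G at s. *)
Lemma vanish_free1 r i s : vanish i.+1 s (free1 r).
Proof.
elim: s r => [|s IHs] r.
  by move=> x [//|->] _; exists 0; [right|rewrite cube_d0].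
apply: (vanish_retract (@free_retractK r)); case: r => [|r].
  apply: vanish_zero => t [x x0]; apply: val_inj => /=.
  apply/ffunP=> z; have [|u ->] := @oi_raise_onto _ _ _ z; first by case.
  move/asboolP: x0 => /(congr1 (fun f : lin_hom 0 t => f u)).
  by rewrite !ffunE.
pose q g := corestr (W := OIker (free_retract r.+1)) (@free_retract_graft r g).
pose p g := OIcomp (free_head r g) (OIincl (OIker (free_retract r.+1))).
apply: (vanish_decomp (p := p) (q := q)) => [t x|g]; last exact: IHs.
exists (enum G) => t' ut' st'; apply: val_inj => /=.
rewrite {1}[LHS](free_ker_decomp (sub_lmodP x)).
have -> : val (\sum_(j <- t') OIfun (q j) t (OIfun (p j) t x)) =
    \sum_(j <- t') OIfun (free_graft r j) t (OIfun (free_head r j) t (val x)).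
  exact: (linear_sum (sub_val _)).
rewrite [RHS]big_uniq //; apply: eq_bigl => g.
by rewrite st' // mem_enum.
Qed.

Section DirectSum.
Variables (I : choiceType) (M : I -> OImod).

Lemma dsum_proj_linear i s : linear (fun x : dsum_module M s => x i).
Proof. by []. Qed.

Lemma dsum_projP i r s (a : lin_hom r s) (x : dsum_module M r) :
  mk_linear (@dsum_proj_linear i s) (OIact a x) =
  OIact a (mk_linear (@dsum_proj_linear i r) x).
Proof. by []. Qed.

Definition dsum_proj i : OIhom (dsum_module M) (M i) :=
  {| OIfun := fun s => mk_linear (@dsum_proj_linear i s); OIfunP := @dsum_projP i |}.

Lemma dsum_inj_linear i s : linear (fun x : M i s => dsum_inj x).
Proof.
move=> a x y; apply: dsum_ext => j; rewrite /dsum_inj dsumDE dsumZE.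
have [<-|ij] := eqVneq i j; first by rewrite !dinj_same.
by rewrite !dinj_diff // scaler0 addr0.
Qed.

Lemma dsum_inclP i r s (a : lin_hom r s) (x : M i r) :
  mk_linear (@dsum_inj_linear i s) (OIact a x) =
  OIact a (mk_linear (@dsum_inj_linear i r) x).
Proof. exact: esym (@dsum_inj_act G k I M r s a i x). Qed.

Definition dsum_incl i : OIhom (M i) (dsum_module M) :=
  {| OIfun := fun s => mk_linear (@dsum_inj_linear i s); OIfunP := @dsum_inclP i |}.

Lemma vanish_dsum i s : (forall j, vanish i s (M j)) -> vanish i s (dsum_module M).
Proof.
apply: (vanish_decomp (p := dsum_proj) (q := dsum_incl)) => r x.
have [t [_ xt _]] := dsum_support x x; exists t => t' ut' st'.
apply: dsum_decomp => // j jt'; apply: xt; apply: contraNN jt'; exact: st'.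
Qed.
End DirectSum.

Lemma vanish_cover i s V : vanish i.+1 s (free_cover V).
Proof. by apply: vanish_dsum => j; exact: vanish_free1. Qed.

(** * From the cube to Tor *)

(** The summand of the full subset S = [s], which is the whole degree 0 part. *)
Fixpoint cube_top s V : V s -> cube s V :=
  if s is s'.+1 then fun v => (cube_top (s := s') (V := shift V) v, 0) else id.

Lemma cube_top_linear s V : linear (@cube_top s V).
Proof.
elim: s V => [//|s IHs] V a v w /=; rewrite IHs; congr pair.
by rewrite /= scaler0 addr0.
Qed.

Lemma cube_top0 s V : @cube_top s V 0 = 0.
Proof. exact: (linear0 (mk_linear (@cube_top_linear s V))). Qed.

Lemma cube_topD s V v w : @cube_top s V (v + w) = cube_top v + cube_top w.
Proof. exact: (linearD (mk_linear (@cube_top_linear s V))). Qed.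

Lemma cube_topB s V v w : @cube_top s V (v - w) = cube_top v - cube_top w.
Proof. exact: (linearB (mk_linear (@cube_top_linear s V))). Qed.

Lemma homog_top s V (v : V s) : homog 0 (cube_top v).
Proof. by elim: s V v => [|s IHs] V v /=; [left|split; first exact: IHs]. Qed.

Lemma homog0P s V (x : cube s V) : homog 0 x -> exists v, x = cube_top v.
Proof.
elim: s V x => [|s IHs] V x /=; first by exists x.
by case: x => x1 x2 /= [/IHs[v ->] ->]; exists v.
Qed.

Lemma cube_map_top s V W (f : OIhom V W) (v : V s) :
  cube_map f (cube_top v) = cube_top (OIfun f s v).
Proof. by elim: s V W f v => [//|s IHs] V W f v /=; rewrite IHs cube_map0. Qed.

Lemma mmul_unshift s V (v : shift V s) : mmul (shift V) s v -> mmul V s.+1 v.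
Proof.
elim=> [|x y _ hx _ hy|r a w rs]; [exact: mmul_0|exact: mmul_D|].
exact: (@mmul_act G k V s.+1 r.+1 (lin_shift a) w).
Qed.

Lemma cube_dZ s V (a : k) (x : cube s V) : cube_d (a *: x) = a *: cube_d x.
Proof. exact: linearZ. Qed.

Lemma cube_topZ s V (a : k) (v : V s) : cube_top (a *: v) = a *: cube_top v.
Proof. exact: (linearZ_LR (mk_linear (@cube_top_linear s V))). Qed.

(** Together with its converse below: the boundaries in degree 0 are mV, hence
the degree 0 homology of the cube is H0. *)
Lemma boundary_mmul s V (v : V s) (y : cube s V) :
  homog 1 y -> cube_d y = cube_top v -> mmul V s v.
Proof.
elim: s V v y => [|s IHs] V v y /=; first by move=> _ <-; exact: mmul_0.
case: y => y1 y0 /= [h1 /homog0P[u ->]] [+ _].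
rewrite cube_map_top => e.
have /IHs : cube_d y1 = cube_top (V := shift V) (v - OIfun (to_shift V) s u).
  by rewrite cube_topB -e addrK.
move=> /(_ h1)/mmul_unshift hv.
rewrite -[v](subrK (OIfun (to_shift V) s u)).
by apply: (@mmul_D G k V) => //; exact: (@mmul_act G k V s.+1 s).
Qed.

(** It suffices to treat x w for a morphism x : r -> s with r < s.  If x misses the
least element it factors through the inclusion of the last elements, and x w
is in the image of the second component of the cone; otherwise x w is the
action on shift V of a shorter morphism, and induction applies. *)
Lemma mmul_boundary s V (v : V s) : mmul V s v ->
  exists2 y : cube s V, homog 1 y & cube_d y = cube_top v.
Proof.
have bD s' V' (v1 v2 : V' s') :
    (exists2 y : cube s' V', homog 1 y & cube_d y = cube_top v1) ->
    (exists2 y : cube s' V', homog 1 y & cube_d y = cube_top v2) ->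
    exists2 y : cube s' V', homog 1 y & cube_d y = cube_top (v1 + v2).
  move=> [y1 h1 d1] [y2 h2 d2]; exists (y1 + y2); first exact: homogD.
  by rewrite cube_dD d1 d2 cube_topD.
have bZ s' V' (a : k) (v1 : V' s') :
    (exists2 y : cube s' V', homog 1 y & cube_d y = cube_top v1) ->
    exists2 y : cube s' V', homog 1 y & cube_d y = cube_top (a *: v1).
  move=> [y1 h1 d1]; exists (a *: y1).
    by rewrite -[_ *: _]addr0; apply: homogP => //; exact: homog0.
  by rewrite cube_dZ d1 cube_topZ.
have b0 s' V' : exists2 y : cube s' V', homog 1 y & cube_d y = cube_top 0.
  by exists 0; [exact: homog0|rewrite cube_d0 cube_top0].
suff act s' : forall V' r (x : oi_hom G r s') (w : V' r), (r < s')%N ->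
    exists2 y : cube s' V', homog 1 y & cube_d y = cube_top (OIact (lin_base x) w).
  elim=> [|x y _ hx _ hy|r a w rs]; [exact: b0|exact: bD|].
  rewrite (lin_hom_dec a) -[OIact _ w]/(mk_linear (OIact_linl (s := s) w) _).
  rewrite linear_sum; elim/big_ind: _ => [|x y|x _]; [exact: b0|exact: bD|].
  by rewrite linearZ; apply: bZ; exact: act.
elim: s' => [//|s' IHs] V' r x w rs.
have raised u : exists2 y : cube s'.+1 V', homog 1 y &
    cube_d y = cube_top (OIact (lin_base (oi_raise u)) w).
  exists (0, cube_top (OIact (lin_base u) w)) => /=.
    by split; [exact: homog0|exact: homog_top].
  rewrite cube_d0 add0r cube_map_top cube_d_homog0; last exact: homog_top.
  by rewrite oppr0 /= -OIact_comp lin_comp_raise.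
case: r x w rs raised => [|r] x w rs raised.
  by have [|u ->] := @oi_raise_onto _ _ _ x; [case|exact: raised].
have [[u ->]|[g [u ->]]] := oi_leastP x; first exact: raised.
have [y h1 d1] := IHs (shift V') r u (OIact (lin_base (oi_cons g (oi_id G r))) w) rs.
exists (y, 0) => /=; first by split=> //; exact: homog0.
rewrite d1 cube_map0 addr0 cube_d0 oppr0; congr (cube_top _, _).
rewrite -[LHS]/(OIact (lin_shift (lin_base u)) _) -OIact_comp lin_shift_base.
by rewrite lin_comp_base oi_comp_cons mul1g oi_comp1r.
Qed.

Lemma vanish0_mmul s V : vanish 0 s V <-> (forall v, mmul V s v).
Proof.
split=> [vV v|mV x /homog0P[v ->] _]; last exact: mmul_boundary.
have [||y hy dy] := vV (cube_top v); first exact: homog_top.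
  by rewrite cube_d_homog0 //; exact: homog_top.
exact: boundary_mmul hy dy.
Qed.
Lemma mmul_lift V W (f : OIhom V W) s (w : W s) : surjective_hom f ->
  mmul W s w -> exists2 v, mmul V s v & OIfun f s v = w.
Proof.
move=> fS; elim=> [|x y _ [x' hx <-] _ [y' hy <-]|r a w' rs].
- by exists 0; [exact: mmul_0|exact: linear0].
- by exists (x' + y'); [exact: mmul_D|exact: linearD].
have [v' <-] := fS r w'; exists (OIact a v'); first exact: mmul_act.
exact: OIfunP.
Qed.

(** Dimension shifting: free covers are acyclic, so H_(i+1) of the j-th syzygy is
H_(j+i+1) of V. *)
Lemma vanish_syzygy i j s V : vanish (j + i.+1) s V -> vanish i.+1 s (syzygy V j).
Proof.
elim: j i => [//|j IHj] i; rewrite addSnnS => /IHj vZ.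
apply: (vanish_left (@incl_inj _ _) (@cover_map_surj _ _ (syzygy V j))
  (@ker_exact _ _ _) _ vZ).
exact: vanish_cover.
Qed.

(** Tor_(j+1)(V) is the kernel of the map that H0 gives from the inclusion of the
(j+1)-st syzygy into the j-th free cover, so this is the vanishing of
Tor_(j+1)(V)_s. *)
Lemma syzygy_mmul j s V (z : syzygy V j.+1 s) : vanish j.+1 s V ->
  mmul (free_cover (syzygy V j)) s (OIfun (OIincl _) s z) -> mmul _ s z.
Proof.
move=> vV /mmul_boundary[y hy dy]; rewrite -addn1 in vV.
have vZ := vanish_syzygy vV.
have [|y' hy' dy'] := vanish_boundary (@incl_inj _ _)
  (@cover_map_surj _ _ (syzygy V j)) (@ker_exact _ _ _) (a := cube_top z) vZ hy.
  by rewrite cube_map_top.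
exact: boundary_mmul hy' dy'.
Qed.

Lemma H0_boundary i s V (u : free_cover (syzygy V i) s) : vanish i s V ->
  H0_cycles (std_resolution V) i s (lpi (mmul _ s) u) ->
  H0_boundaries (std_resolution V) i s (lpi (mmul _ s) u).
Proof.
move=> vV hu.
have mu : mmul (syzygy V i) s (OIfun (cover_map (syzygy V i)) s u).
  case: i u vV hu => [|i] u vV; first by move=> _; exact: (iffLR (vanish0_mmul s V)).
  rewrite -[H0_cycles _ _ _ _]/(H0_fun _ _ = 0) H0_funE => /lpi_eq.
  rewrite subr0 => hu; exact: syzygy_mmul.
have [u' hu' e] := mmul_lift (@cover_map_surj _ _ _) mu.
have ku : OIfun (cover_map (syzygy V i)) s (u - u') = 0.
  by rewrite linearB e subrr.
have [y ye] := iffLR (@std_d_exact _ _ V i s (u - u')) ku.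
exists (lpi (mmul _ s) y); rewrite -[LHS]/(H0_fun _ _) H0_funE.
by apply/lpi_eq; rewrite ye addrAC subrr add0r; exact: lsubN.
Qed.

Lemma Tor_vanish i s V : vanish i s V -> forall x : OI_Tor i V s, x = 0.
Proof.
move=> vV; elim/lquot_ind=> q; apply/lpi_eq; rewrite subr0.
have := sub_lmodP q; rewrite -[OIpreim _ _ _ _]/(H0_boundaries _ _ _ (val q)).
by move: (val q); elim/lquot_ind=> u; exact: H0_boundary.
Qed.

Lemma supremum_le (x0 b : \bar int) A :
  (x0 <= b)%E -> (forall y, A y -> (y <= b)%E) -> (supremum x0 A <= b)%E.
Proof.
move=> x0b Ab; have [->|/set0P A0] := eqVneq A set0; first by rewrite supremum0.
by case: (bar_int_supremumP x0 A0) => _; apply.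
Qed.

Lemma reg_le_reg N V : reg_le N V -> (reg V < +oo)%E.
Proof.
move=> vV; apply: (@le_lt_trans _ _ (N%:Z)%:E); last exact: ltry.
apply: supremum_le => [|_ [i _ <-]]; first exact: leNye.
rewrite leeBlDr // -EFinD; apply: supremum_le => [|_ [s [x x0] <-]].
  by rewrite lee_fin; lia.
rewrite lee_fin lez_nat leqNgt; apply/negP => /vV/Tor_vanish/(_ x); exact: x0.
Qed.
Implicit Types (A B C P : OImod).

(** * Modules whose submodules all have finite regularity *)

(** Stated for modules embedded in P rather than for submodules of P, so that it
passes to the source of any injection without transport. *)
Definition bounded_submodules P := forall U (f : OIhom U P),
  injective_hom f -> exists N, reg_le N U.

Lemma reg_le_middle N N' A B C (f : OIhom A B) (g : OIhom B C) :
  injective_hom f -> surjective_hom g -> exact_hom f g ->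
  reg_le N A -> reg_le N' C -> reg_le (maxn N N') B.
Proof.
move=> fI gS fg vA vC i s lt.
by apply: (vanish_middle fI gS fg); [apply: vA|apply: vC]; lia.
Qed.

Lemma reg_le_right N N' A B C (f : OIhom A B) (g : OIhom B C) :
  injective_hom f -> surjective_hom g -> exact_hom f g ->
  reg_le N A -> reg_le N' B -> reg_le (maxn N N') C.
Proof.
move=> fI gS fg vA vB [|i] s lt; first by apply: (vanish_right0 gS); apply: vB; lia.
by apply: (vanish_right fI gS fg); [apply: vA|apply: vB]; lia.
Qed.

Lemma reg_le_ker_im N N' V W (f : OIhom V W) :
  reg_le N (submodule_module (OIker f)) -> reg_le N' (submodule_module (OIim f)) ->
  reg_le (maxn N N') V.
Proof.
have fW s x : OIim f s (OIfun f s x) by exists x.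
apply: (reg_le_middle (g := corestr fW)); first exact: incl_inj.
  by move=> s y; have [x xy] := sub_lmodP y; exists x; exact: val_inj.
move=> s y; rewrite -ker_exact; split=> [/(congr1 val)//|fy].
exact: val_inj.
Qed.

Lemma bounded_extension P C (p : OIhom P C) : bounded_submodules C ->
  bounded_submodules (submodule_module (OIker p)) -> bounded_submodules P.
Proof.
move=> bC bK U f fI; pose h := OIcomp p f.
have [N vI] := bC _ _ (@incl_inj _ (OIim h)).
have hK s x : OIker p s (OIfun (OIcomp f (OIincl (OIker h))) s x).
  exact: (sub_lmodP x).
have [|N' vK] := bK _ (corestr hK); last by exists (maxn N' N); exact: reg_le_ker_im vI.
by move=> s x y /(congr1 val)/fI; exact: val_inj.
Qed.

Lemma bounded_zero P : (forall s (x : P s), x = 0) -> bounded_submodules P.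
Proof.
move=> P0 U f fI; exists 0%N => i s _; apply: vanish_zero => r x.
by apply: fI; rewrite linear0; exact: P0.
Qed.

Lemma bounded_joint (I : eqType) (C : I -> OImod) (l : seq I) P
    (p : forall i, OIhom P (C i)) :
  (forall i, bounded_submodules (C i)) ->
  (forall s (x : P s), (forall i, i \in l -> OIfun (p i) s x = 0) -> x = 0) ->
  bounded_submodules P.
Proof.
move=> bC; elim: l P p => [|j l IHl] P p pI.
  by apply: bounded_zero => s x; exact: pI.
apply: (bounded_extension (p := p j)) => //.
apply: (IHl _ (fun i => OIcomp (p i) (OIincl (OIker (p j))))) => s x px.
apply: val_inj; apply: pI => i; rewrite inE => /predU1P[->|]; last exact: px.
exact: (sub_lmodP x).
Qed.

(** Elements of M are determined by finitely many coordinates in k.  For one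
coordinate c, the ideal of the values of c on the union of the chain is finitely
generated, hence is attained at some stage; the remaining coordinates are
treated by applying the induction hypothesis to the elements on which c
vanishes. *)
Lemma chain_stationary (M : lmodType k) (T : eqType) (c : T -> {linear M -> k^o})
    (ts : seq T) (U : nat -> lsub M) : noetherian k ->
  (forall m n x, (m <= n)%N -> U m x -> U n x) ->
  (forall n x, U n x -> (forall t, t \in ts -> c t x = 0) -> x = 0) ->
  exists n, forall m x, U m x -> U n x.
Proof.
move=> kN; elim: ts U => [|t ts IHt] U Umono Uts.
  by exists 0%N => m x /Uts->; [exact: lsub0|].
pose Iset (a : k^o) := exists n x, U n x /\ c t x = a.
have I0 : Iset 0 by exists 0%N, 0; split; [exact: lsub0|exact: linear0].
have IP (a : k) x y : Iset x -> Iset y -> Iset (a *: x + y).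
  move=> [m [u [Uu <-]]] [n [v [Uv <-]]]; exists (maxn m n), (a *: u + v).
  split; last exact: linearP.
  by apply: lsubP; [apply: Umono Uu; exact: leq_maxl|apply: Umono Uv; exact: leq_maxr].
have [gens [gI Igens]] := kN (LSub I0 IP).
have [n1 n1P] : exists n, forall a, a \in gens -> exists2 x, U n x & c t x = a.
  elim: gens gI {Igens} => [|a gens IHg] gI; first by exists 0%N.
  have [|n nP] := IHg; first by move=> b bg; apply: gI; rewrite inE bg orbT.
  have [m [x [Ux xa]]] := gI a (mem_head _ _).
  exists (maxn m n) => b; rewrite inE => /predU1P[->|/nP[y Uy yb]].
    by exists x => //; apply: Umono Ux; exact: leq_maxl.
  by exists y => //; apply: Umono Uy; exact: leq_maxr.
have J0 : exists2 x, U n1 x & c t x = 0 by exists 0; [exact: lsub0|exact: linear0].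
have JP (a : k) (x y : k^o) : (exists2 u, U n1 u & c t u = x) ->
    (exists2 u, U n1 u & c t u = y) -> exists2 u, U n1 u & c t u = a *: x + y.
  move=> [u Uu <-] [v Uv <-]; exists (a *: u + v); first exact: lsubP.
  exact: linearP.
have n1I m x : U m x -> exists2 y, U n1 y & c t y = c t x.
  by move=> Ux; apply: (Igens (LSub J0 JP)) => //; exists m, x.
have K0 n : U n 0 /\ c t 0 = 0 by split; [exact: lsub0|exact: linear0].
have KP n (a : k) x y : U n x /\ c t x = 0 -> U n y /\ c t y = 0 ->
    U n (a *: x + y) /\ c t (a *: x + y) = 0.
  move=> [Ux x0] [Uy y0]; split; first exact: lsubP.
  by rewrite linearP x0 y0 scaler0 addr0.
have [||n2 n2P] := IHt (fun n => LSub (K0 n) (KP n)).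
- by move=> m n x mn /= [Ux x0]; split=> //; exact: Umono Ux.
- move=> n x /= [Ux x0] xts; apply: Uts Ux _ => t'.
  by rewrite inE => /predU1P[->|/xts].
exists (maxn n1 n2) => m x Ux; have [y Uy yx] := n1I m x Ux.
have [Uxy _] : U n2 (x - y) /\ c t (x - y) = 0.
  apply: (n2P (maxn m n1)); split; last by rewrite linearB yx subrr.
  apply: lsubD; first by apply: Umono Ux; exact: leq_maxl.
  by apply: lsubN; apply: Umono Uy; exact: leq_maxr.
rewrite -(subrK y x); apply: lsubD; first by apply: Umono Uxy; exact: leq_maxr.
by apply: Umono Uy; exact: leq_maxl.
Qed.

(** * Submodules of free modules *)

Section FreeModule.
Variable d : nat.
Hypothesis kN : noetherian k.
Hypothesis lower : bounded_submodules (submodule_module (OIker (free_retract d))).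
Implicit Types X : OIsub (free1 d).

Definition truncate_hom X : OIhom (shift (submodule_module X)) (free1 d) :=
  OIcomp (free_retract d) (shift_map (OIincl X)).

(** The submodule of the elements of W s.+1, with their coefficients on the
morphisms that hit the least element erased. *)
Definition truncate X : OIsub (free1 d) := OIim (truncate_hom X).

Lemma truncate_ge X s x : X s x -> truncate X s x.
Proof.
move=> Wx; exists (OIact (lin_raise s) (in_sub Wx : submodule_module X s)).
exact: free_retractK.
Qed.

Lemma truncate_ker_bounded X V (f : OIhom (shift (submodule_module X)) V) :
  (forall s x, OIfun f s x = 0 -> OIfun (truncate_hom X) s x = 0) ->
  exists N, reg_le N (submodule_module (OIker f)).
Proof.
move=> fp; pose h := OIcomp (shift_map (OIincl X)) (OIincl (OIker f)).
have hK s x : OIker (free_retract d) s (OIfun h s x).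
  exact: fp (sub_lmodP x).
by apply: (lower (f := corestr hK)) => s x y /(congr1 val) e; do 2!apply: val_inj.
Qed.

(** shift W is an extension of its image [truncate W] by a module that embeds in
the kernel of the retraction of shift M(d), which has lower degree. *)
Lemma truncate_bounded X : (exists N, reg_le N (submodule_module (truncate X))) ->
  exists N, reg_le N (submodule_module X).
Proof.
move=> [N vP]; have [N' vK] := truncate_ker_bounded (f := truncate_hom X) (fun s x => id).
by exists (maxn N' N).+1; apply: reg_le_unshift; exact: reg_le_ker_im vP.
Qed.

(** Now the retraction of shift M(d) restricts to a retraction of shift W onto
W. *)
Lemma saturated_bounded X : (forall s x, truncate X s x -> X s x) ->
  exists N, reg_le N (submodule_module X).
Proof.
move=> sat; have pW s x : X s (OIfun (truncate_hom X) s x) by apply: sat; exists x.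
have [|N vK] := truncate_ker_bounded (f := corestr pW).
  by move=> s x /(congr1 val).
exists N.+1; apply: reg_le_retract vK => s x; apply: val_inj.
exact: free_retractK.
Qed.

Section Saturation.
Variable W : OIsub (free1 d).
Let Wn n := iter n truncate W.

Lemma iter_truncate_mono m n s x : (m <= n)%N -> Wn m s x -> Wn n s x.
Proof.
move=> /subnK <-; elim: (n - m)%N => [//|j IHj] /IHj; exact: truncate_ge.
Qed.

Definition saturation_set s x := exists n, Wn n s x.

Lemma saturation0 s : saturation_set (0 : free1 d s).
Proof. by exists 0%N; exact: lsub0. Qed.

Lemma saturationP s (a : k) (x y : free1 d s) :
  saturation_set x -> saturation_set y -> saturation_set (a *: x + y).
Proof.
move=> [m xm] [n yn]; exists (maxn m n).
by apply: lsubP; [apply: iter_truncate_mono xm; exact: leq_maxl|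
                  apply: iter_truncate_mono yn; exact: leq_maxr].
Qed.

Lemma saturation_act r s (a : lin_hom r s) (x : free1 d r) :
  saturation_set x -> saturation_set (OIact a x).
Proof. by move=> [n xn]; exists n; exact: OIsubP. Qed.

Definition saturation : OIsub (free1 d) :=
  {| OIsub_lsub := fun s => LSub (saturation0 s) (@saturationP s);
     OIsubP := saturation_act |}.

Lemma saturation_saturated s x : truncate saturation s x -> saturation s x.
Proof.
move=> [w <-]; have [n wn] := sub_lmodP w; exists n.+1.
by exists (in_sub wn : submodule_module (Wn n) s.+1).
Qed.

(** Finite regularity bounds the degrees of generators of the saturation, and in
each of the finitely many degrees up to this bound the chain is stationary. *)
Lemma saturation_reached : exists n, forall s x, saturation s x -> Wn n s x.
Proof.
have [N vS] := saturated_bounded saturation_saturated.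
have stat s : exists n, forall x, saturation s x -> Wn n s x.
  have cL (t : oi_hom G d s) : linear (fun x : free1 d s => (x : lin_hom d s) t : k^o).
    by move=> a x y; rewrite !ffunE.
  have [||n nP] := chain_stationary (c := fun t => mk_linear (cL t))
      (ts := enum {: oi_hom G d s}) (U := fun n => Wn n s) kN.
  - by move=> m n x; exact: iter_truncate_mono.
  - move=> n x _ x0; apply/ffunP=> t; rewrite ffunE; apply: x0.
    by rewrite mem_enum.
  by exists n => x [m xm]; exact: nP xm.
have [n nP] : exists n, forall s x, (s <= N)%N -> saturation s x -> Wn n s x.
  elim: N {vS} => [|N [n nP]].
    by have [n nP] := stat 0%N; exists n => s x; rewrite leqn0 => /eqP s0; subst s; exact: nP.
  have [m mP] := stat N.+1; exists (maxn n m) => s x.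
  rewrite leq_eqVlt ltnS => /predU1P[sN|sN] Sx.
    by subst s; apply: (@iter_truncate_mono m); [exact: leq_maxr|exact: mP].
  by apply: (@iter_truncate_mono n); [exact: leq_maxl|exact: nP].
exists n => s; have [m] := ubnP s; elim: m s => // m IHm s sm x Sx.
have [sN|Ns] := leqP s N; first exact: nP.
have /vanish0_mmul/(_ (in_sub Sx : submodule_module saturation s)) :
  vanish 0 s (submodule_module saturation) by apply: vS; rewrite addn0.
rewrite -[x]/(sub_val _ (in_sub Sx : submodule_module saturation s)).
elim=> [|y z _ hy _ hz|r a w rs]; first by rewrite linear0; exact: lsub0.
  by rewrite linearD; exact: lsubD.
apply: (@OIsubP _ _ _ (Wn n)); apply: IHm; last exact: (sub_lmodP w).
exact: leq_trans rs _.
Qed.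

(** A stage that has reached the saturation is saturated itself; from there
[truncate_bounded] leads down to W, one stage at a time. *)
Lemma submodule_bounded : exists N, reg_le N (submodule_module W).
Proof.
have [n nP] := saturation_reached.
suff step j : (j <= n)%N -> exists N, reg_le N (submodule_module (Wn (n - j))).
  by have := step n (leqnn n); rewrite subnn.
elim: j => [_|j IHj jn].
  rewrite subn0; apply: saturated_bounded => s x px.
  by apply: nP; exists n.+1.
apply: truncate_bounded; rewrite -[truncate _]/(Wn (n - j.+1).+1) -subSn // subSS.
exact: IHj (ltnW jn).
Qed.
End Saturation.

Lemma bounded_free_step : bounded_submodules (free1 d).
Proof.
move=> U f fI; have [N vI] := submodule_bounded (OIim f).
exists (maxn 0 N); apply: reg_le_ker_im vI => i s _; apply: vanish_zero => r x.
by apply: val_inj; apply: fI; rewrite linear0; exact: (sub_lmodP x).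
Qed.
End FreeModule.

Lemma bounded_free d : noetherian k -> bounded_submodules (free1 d).
Proof.
move=> kN; elim: d => [|d IHd]; apply: bounded_free_step => //.
  apply: bounded_zero => s x; apply: val_inj => /=; apply/ffunP=> z.
  have [|u ->] := @oi_raise_onto _ _ _ z; first by case.
  have /(congr1 (fun f : lin_hom 0 s => f u)) := sub_lmodP x.
  by rewrite !ffunE.
pose p g := OIcomp (free_head d g) (OIincl (OIker (free_retract d.+1))).
apply: (bounded_joint (p := p) (l := enum G)) => // s x px.
apply: val_inj; rewrite [LHS](free_ker_decomp (sub_lmodP x)) big1 // => g _.
rewrite -[OIfun (free_head d g) s _]/(OIfun (p g) s x).
by rewrite px ?linear0 // mem_enum.
Qed.

Lemma id_homP V r s (a : lin_hom r s) (v : V r) :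
  idfun (OIact a v) = OIact a (idfun v).
Proof. by []. Qed.

Definition id_hom V : OIhom V V :=
  {| OIfun := fun s => idfun : {linear V s -> V s}; OIfunP := @id_homP V |}.

Lemma finitely_generated_reg_le V : noetherian k -> finitely_generated V ->
  exists N, reg_le N V.
Proof.
move=> kN [gens gensP].
pose I : finType := seq_sub gens; pose M (i : I) := free1 (tag (ssval i)).
pose P := dsum_module M.
pose f : OIhom P V := dsum_hom (fun i : I => free1_hom (tagged (ssval i))).
have fS : surjective_hom f.
  move=> s v; apply: (gensP (OIim f)) => x xg; pose i : I := SeqSub xg.
  exists (dsum_inj (lin_id G k (tag x) : M i (tag x))).
  by rewrite [LHS]dsum_rec_inj /= OIact_id.
have bP : bounded_submodules P.
  apply: (bounded_joint (p := fun i : I => dsum_proj M i) (l := enum I)) => [i|s x px].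
    exact: bounded_free.
  by apply: dsum_ext => i; apply: px; rewrite mem_enum.
have [N vK] := bP _ _ (@incl_inj _ (OIker f)).
have [|N' vP] := bP P (id_hom P); first by move=> s x y.
by exists (maxn N N'); exact: (reg_le_right (@incl_inj _ _) fS (@ker_exact _ _ f) vK vP).
Qed.

End Regularity.

Theorem corollary1p14 (k : comPzRingType) (G : finGroupType) (V : OImod G k) :
  noetherian k -> finitely_generated V -> (reg V < +oo)%E.
Proof. by move=> kN /(finitely_generated_reg_le kN)[N /reg_le_reg]. Qed.
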